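(* Let $K$ be a number field, $n>2$ an integer and $t$ a positive integer with $t\mid n$. Then there exists an extension $L/K$ of degree $n$ with ascending index $t_K(L)=t$.
   Context: For a finite extension $L/K$ (inside a fixed algebraic closure), the ascending index $t_K(L)=[F:K]$, where $F$ is the unique subfield of $L$ that is Galois over $K$ of maximum possible degree. *)

(* Defs.v *)
From HB Require Import structures.
From mathcomp Require Import all_boot all_order all_algebra all_field.
Set Implicit Arguments. Unset Strict Implicit. Unset Printing Implicit Defensive.
Import GRing.Theory.
Local Open Scope ring_scope.

(* Number fields are modelled as subfields of a finite Galois extension E of
   Q (a splittingFieldType rat); within such an E, [galois K F] is genuine
   Galois-ness of F/K.  [has_ascending_index K L t] : t = [F:K] where F is a
   subfield of L that is Galois over K of maximal degree. *)
Definition has_ascending_index (E : splittingFieldType rat)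
    (K L : {vspace E}) (t : nat) : Prop :=
  exists F : {subfield E},
    [/\ (F <= L)%VS, galois K F, \dim_K F = t &
        forall F' : {subfield E}, (F' <= L)%VS -> galois K F' -> (\dim_K F' <= t)%N].

(* Main.v *)
Require Import Defs.
From HB Require Import structures.
From mathcomp Require Import all_boot all_order all_fingroup all_algebra.
From mathcomp Require Import all_solvable all_field.
From mathcomp Require Import zify ring lra.
From Stdlib Require Import ClassicalEpsilon.
Set Implicit Arguments. Unset Strict Implicit. Unset Printing Implicit Defensive.
Import AEnd_FinGroup.
Import Order.TTheory GRing.Theory Num.Theory.
Local Open Scope group_scope.
Local Open Scope ring_scope.

(**
Write n = t m.  For k large the degree of K(zeta)/K, zeta a root of unity of
order t^k, is divisible by t, because cyclotomic polynomials are irreducible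
over Q; as this extension is abelian it contains some F Galois of degree t over
K.  It remains to find L/F of degree m such that every Galois extension of K
inside L lies in F.

- m = 2: L = F(sqrt a), where a is a uniformizer at some place of degree one of
  F while a conjugate x(a) over K is a unit there.  Then neither x(a) nor x(a)/a
  is a square in F, so that L contains no square root of x(a).
- m > 2: L = F(alpha), with alpha a root of
  f = X^m + q1 X^(m-1) + q1 q2 for suitable primes q1 and q2.  It is Eisenstein
  at q1; at q2 it has a simple root close to -q1, and the complementary factor
  is Eisenstein, so that f/(X - alpha) stays irreducible over F(alpha).  Let
  beta = s(alpha), deg s < m, lie in a Galois extension of K inside L.  For
  another root alpha' of f, s(alpha') is also in L, hence f/(X - alpha) divides
  s(X) - s(alpha'), and comparing the coefficients of X^(m-1) and X^(m-2) shows
  that s is constant.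

The places needed have uniformizer a rational prime; they come from the q-adic
absolute value of Q, extended along simple roots: alpha is approximated by the
Hensel iterates a_k of a root modulo q, and |s(alpha)| is the eventual value of
|s(a_k)|.
*)

(** * Discrete absolute values on a subfield *)

Section Place.
Variables (F0 : fieldType) (L : fieldExtType F0).

(* [N] is a junk value outside [U]. *)
Record place (U : {vspace L}) (q : nat) (N : L -> rat) : Prop := Place {
  place_gt1 : (1 < q)%N;
  place_ge0 : {in U, forall x, 0 <= N x};
  place_eq0 : {in U, forall x, (N x == 0) = (x == 0)};
  placeM : {in U &, {morph N : x y / x * y}};
  placeD : {in U &, forall x y, N (x + y) <= Num.max (N x) (N y)};
  place_unif : N q%:R = q%:R^-1;
  place_discrete : {in U, forall x, N x < 1 -> N x <= q%:R^-1} }.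

Variables (U : {subfield L}) (q : nat) (N : L -> rat).
Hypothesis plN : place U q N.

Let rho : rat := q%:R^-1.

Lemma place_rho_gt0 : 0 < rho.
Proof. by rewrite invr_gt0 ltr0n ltnW // (place_gt1 plN). Qed.

Lemma place_rho_lt1 : rho < 1.
Proof.
by rewrite invf_lt1 ?ltr1n ?(place_gt1 plN) // ltr0n ltnW // (place_gt1 plN).
Qed.

Lemma place0 : N 0 = 0.
Proof. by apply/eqP; rewrite (place_eq0 plN) ?mem0v. Qed.

Lemma place_gt0 x : x \in U -> x != 0 -> 0 < N x.
Proof.
by move=> Ux x0; rewrite lt_def (place_eq0 plN) // x0 (place_ge0 plN).
Qed.

Lemma place1 : N 1 = 1.
Proof.
have N1: 0 < N 1 by apply: place_gt0; rewrite ?mem1v ?oner_eq0.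
have /eqP := placeM plN (mem1v U) (mem1v U).
by rewrite mulr1 -subr_eq0 -{1}[N 1]mulr1 -mulrBr mulf_eq0 gt_eqF //= subr_eq0 => /eqP.
Qed.

Lemma placeX n : {in U, {morph N : x / x ^+ n}}.
Proof.
move=> x Ux; elim: n => [|n IHn]; first by rewrite !expr0 place1.
by rewrite !exprS (placeM plN) ?rpredX // IHn.
Qed.

Lemma placeV : {in U, {morph N : x / x^-1}}.
Proof.
move=> x Ux; have [-> | x0] := eqVneq x 0; first by rewrite invr0 place0 invr0.
have Nx0: N x != 0 by rewrite (place_eq0 plN).
apply: (mulfI Nx0); rewrite -(placeM plN) ?rpredV // !mulfV ?place1 //.
Qed.

Lemma placeN : {in U, forall x, N (- x) = N x}.
Proof.
move=> x Ux; have U1: (- 1 : L) \in U by rewrite rpredN mem1v.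
suffices N1: N (- 1) = 1 by rewrite -mulN1r (placeM plN) // N1 mul1r.
have := placeX 2 U1; rewrite sqrrN expr1n place1 => /esym/eqP.
rewrite sqrf_eq1 => /orP[/eqP // | /eqP N1].
by have := place_ge0 plN U1; rewrite N1; lra.
Qed.

Lemma placeB : {in U &, forall x y, N (x - y) <= Num.max (N x) (N y)}.
Proof. by move=> x y Ux Uy; rewrite -(placeN Uy) (placeD plN) ?rpredN. Qed.

Lemma placeD_eq : {in U &, forall x y, N y < N x -> N (x + y) = N x}.
Proof.
move=> x y Ux Uy ltyx; apply/eqP; rewrite eq_le.
have := placeD plN Ux Uy; rewrite (max_l (ltW ltyx)) => -> /=.
have := placeB (rpredD Ux Uy) Uy; rewrite addrK le_max => /orP[] // lexy.
by rewrite leNgt ltyx in lexy.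
Qed.

Lemma place_sum_le I (r : seq I) (P : pred I) (G : I -> L) (b : rat) :
  0 <= b -> (forall i, P i -> G i \in U) -> (forall i, P i -> N (G i) <= b) ->
  N (\sum_(i <- r | P i) G i) <= b.
Proof.
move=> b0 UG leG.
suffices [] : \sum_(i <- r | P i) G i \in U /\ N (\sum_(i <- r | P i) G i) <= b by [].
elim/big_ind: _ => [|x y [Ux lex] [Uy ley]|i Pi]; last by rewrite UG ?leG.
  by rewrite mem0v place0.
by split; [rewrite rpredD | rewrite (le_trans (placeD plN Ux Uy)) // ge_max lex].
Qed.

Lemma place_sum_lt I (r : seq I) (P : pred I) (G : I -> L) (b : rat) :
  0 < b -> (forall i, P i -> G i \in U) -> (forall i, P i -> N (G i) < b) ->
  N (\sum_(i <- r | P i) G i) < b.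
Proof.
move=> b0 UG leG.
suffices [] : \sum_(i <- r | P i) G i \in U /\ N (\sum_(i <- r | P i) G i) < b by [].
elim/big_ind: _ => [|x y [Ux lex] [Uy ley]|i Pi]; last by rewrite UG ?leG.
  by rewrite mem0v place0.
by split; [rewrite rpredD | rewrite (le_lt_trans (placeD plN Ux Uy)) // gt_max lex].
Qed.

Lemma place_nat_le n : N n%:R <= 1.
Proof.
elim: n => [|n IHn]; first by rewrite place0.
rewrite -addn1 natrD (le_trans (placeD plN _ _)) ?mem1v ?rpred_nat //.
by rewrite place1 ge_max IHn lexx.
Qed.

(* Together with [place_gauss], a version of Gauss's lemma which also locates the
   coefficients involved. *)
Lemma place_first_max (p : {poly L}) : p \is a polyOver U -> p != 0 ->
  exists i, [/\ (i < size p)%N, forall j, N p`_j <= N p`_i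
              & forall j, (j < i)%N -> N p`_j < N p`_i].
Proof.
move=> Up p0.
have sp: (0 < size p)%N by rewrite size_poly_gt0.
pose i0 := [arg max_(i > Ordinal sp) N p`_(val i)]%O.
have maxi0 j: N p`_j <= N p`_i0.
  rewrite /i0; case: arg_maxP => // i _ maxi.
  have [ltj | lej] := ltnP j (size p); first exact: (maxi (Ordinal ltj)).
  by rewrite nth_default // place0 (place_ge0 plN) // (polyOverP Up).
have ex: exists i, N p`_i == N p`_i0 by exists i0.
case: (ex_minnP ex) => i /eqP Ni mini.
exists i; split=> [|j|j ltji]; last 2 first.
- by rewrite Ni maxi0.
- rewrite Ni lt_neqAle maxi0 andbT; apply: contraL ltji => /mini.
  by rewrite -leqNgt.
by rewrite (leq_ltn_trans (mini i0 _)) //.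
Qed.

(** Among the terms of the coefficient of index [i + j], the one at [i], [j] strictly dominates: any
    other has its first index below [i] or its second below [j]. *)
Lemma place_gauss (p r : {poly L}) i j :
  p \is a polyOver U -> r \is a polyOver U ->
  p`_i != 0 -> r`_j != 0 ->
  (forall k, N p`_k <= N p`_i) -> (forall k, (k < i)%N -> N p`_k < N p`_i) ->
  (forall k, N r`_k <= N r`_j) -> (forall k, (k < j)%N -> N r`_k < N r`_j) ->
  N (p * r)`_(i + j) = N p`_i * N r`_j.
Proof.
move=> Up Ur pi0 rj0 maxp firstp maxr firstr.
have Upk k: p`_k \in U by apply: (polyOverP Up).
have Urk k: r`_k \in U by apply: (polyOverP Ur).
have lti: (i < (i + j).+1)%N by rewrite ltnS leq_addr.
rewrite coefM (bigD1 (Ordinal lti)) //= addKn -(placeM plN) //.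
rewrite placeD_eq ?rpredM ?rpred_sum // => [k _|]; first by rewrite rpredM.
have Npi := place_gt0 (Upk i) pi0; have Nrj := place_gt0 (Urk j) rj0.
rewrite (placeM plN) //.
apply: place_sum_lt => [|k _|k neki]; rewrite ?mulr_gt0 ?rpredM //.
rewrite (placeM plN) //.
have [ltki | leik] := ltnP k i.
  rewrite (le_lt_trans (ler_wpM2l _ (maxr _))) ?(place_ge0 plN) //.
  by rewrite ltr_pM2r ?firstp.
have ltik: (i < k)%N by rewrite ltn_neqAle leik eq_sym andbT.
rewrite (le_lt_trans (ler_wpM2r _ (maxp _))) ?(place_ge0 plN) //.
rewrite ltr_pM2l // firstr //.
by have := ltn_ord k; move: (val k) ltik; clear; lia.
Qed.

(** Let [g = k * h] with [h] the minimal polynomial and [k] not constant. By [place_gauss] the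
    product of the two maxima, which is at least 1, occurs at [i + j]; this must be the top degree.
    So [i] and [j] are top degrees, both constant terms are small, and by discreteness their product
    is at most [rho ^+ 2 < rho]. *)
Lemma place_eisenstein (g : {poly L}) (a : L) :
  g \is a polyOver U -> g \is monic -> root g a ->
  (forall i, (i < (size g).-1)%N -> N g`_i < 1) ->
  N g`_0 = rho -> minPoly U a = g.
Proof.
move=> Ug mong ga0 small g00.
set h := minPoly U a.
have monh : h \is monic := monic_minPoly U a.
have Uh : h \is a polyOver U := minPolyOver U a.
have sh : (1 < size h)%N by rewrite size_minPoly.
have /divpK def_g: h %| g by rewrite minPoly_dvdp.
have{def_g} [k def_g]: exists k, k * h = g by exists (g %/ h).
have Uk: k \is a polyOver U by rewrite (_ : k = g %/ h) ?divp_polyOver // -def_g mulpK ?monic_neq0.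
have monk: k \is monic by rewrite -(monicMr k monh) def_g.
have [sk | sk] := leqP (size k) 1.
  have k1 : k = 1.
    move: monk; rewrite (size1_polyC sk) monicE lead_coefC => /eqP ->.
    by rewrite polyC1.
  by rewrite -def_g k1 mul1r.
have [i [lti maxk firstk]] := place_first_max Uk (monic_neq0 monk).
have [j [ltj maxh firsth]] := place_first_max Uh (monic_neq0 monh).
have ge1 (p : {poly L}) l : p \is monic -> (forall l', N p`_l' <= N p`_l) -> 1 <= N p`_l.
  move=> monp maxp; apply: le_trans (maxp (size p).-1).
  by rewrite -lead_coefE (monicP monp) place1.
have Nki := ge1 _ _ monk maxk; have Nhj := ge1 _ _ monh maxh.
have nz x : 1 <= N x -> x != 0 by apply: contraTneq => ->; rewrite place0 ler10.
have Ng: N g`_(i + j) = N k`_i * N h`_j.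
  by rewrite -def_g; apply: place_gauss; rewrite ?nz.
have sg: (size g).-1 = ((size k).-1 + (size h).-1)%N.
  by rewrite -def_g size_monicM ?monic_neq0 //; move: sk sh; clear; lia.
have [|] := ltnP (i + j) (size g).-1.
  by move/small; rewrite Ng ltNge; rewrite -[1]mulr1 ler_pM.
move=> leij.
have [ei ej k_gt0 h_gt0] : [/\ i = (size k).-1, j = (size h).-1, (0 < i)%N & (0 < j)%N].
  move: (size k) (size h) (size g).-1 sk sh sg lti ltj leij; clear.
  by move=> *; split; lia.
have k0: N k`_0 < 1.
  by rewrite (lt_le_trans (firstk _ k_gt0)) // ei -lead_coefE ?(monicP monk) ?place1.
have h0: N h`_0 < 1.
  by rewrite (lt_le_trans (firsth _ h_gt0)) // ej -lead_coefE ?(monicP monh) ?place1.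
have Uk0 : k`_0 \in U by apply: (polyOverP Uk).
have Uh0 : h`_0 \in U by apply: (polyOverP Uh).
have := g00; rewrite -def_g -horner_coef0 hornerM !horner_coef0 (placeM plN) // => e.
have lek0 := place_discrete plN Uk0 k0; have leh0 := place_discrete plN Uh0 h0.
have := ler_pM (place_ge0 plN Uk0) (place_ge0 plN Uh0) lek0 leh0.
by rewrite e -/rho -subr_le0 -{1}[rho]mulr1 -mulrBr pmulr_rle0 ?place_rho_gt0 //
  subr_le0 leNgt place_rho_lt1.
Qed.

Lemma rho_pow_small (C e : rat) : 0 < e -> exists k0, forall k, (k0 <= k)%N -> C * rho ^+ k < e.
Proof.
move=> e0; pose x := Num.max C 0 / e.
exists (Num.bound x) => k /upper_nthrootP ltx.
have qk: (2%:R ^+ k : rat) <= q%:R ^+ k.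
  by rewrite lerXn2r ?nnegrE ?ler0n // ler_nat (place_gt1 plN).
have q0: 0 < (q%:R : rat) ^+ k by rewrite exprn_gt0 // ltr0n ltnW // (place_gt1 plN).
rewrite exprVn ltr_pdivrMr //; apply: (@le_lt_trans _ _ (Num.max C 0)).
  by rewrite le_max lexx.
by rewrite -ltr_pdivrMl // mulrC (lt_le_trans ltx).
Qed.

(** * Polynomial estimates at a place *)

Lemma place_horner_bound (p : {poly L}) : p \is a polyOver U ->
  exists2 B, 0 <= B & {in U, forall x, N x <= 1 -> N p.[x] <= B}.
Proof.
move=> Up; exists (\sum_(i < size p) N p`_i) => [|x Ux Nx].
  by apply: sumr_ge0 => i _; rewrite (place_ge0 plN) // (polyOverP Up).
rewrite horner_coef; apply: place_sum_le => [|i _|i _].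
- by apply: sumr_ge0 => i _; rewrite (place_ge0 plN) // (polyOverP Up).
- by rewrite rpredM ?rpredX // (polyOverP Up).
have Up_i := polyOverP Up.
rewrite (placeM plN) ?rpredX // placeX // (bigD1 i) //=.
rewrite -[N p`_i * _]addr0 lerD ?sumr_ge0 // => [|j _]; rewrite ?(place_ge0 plN) //.
by rewrite ler_piMr ?(place_ge0 plN) // exprn_ile1 ?(place_ge0 plN).
Qed.

Lemma place_horner_int (p : {poly L}) x : p \is a polyOver U ->
  (forall i, N p`_i <= 1) -> x \in U -> N x <= 1 -> N p.[x] <= 1.
Proof.
move=> Up Np Ux Nx; rewrite horner_coef; apply: place_sum_le => // i _.
  by rewrite rpredM ?rpredX // (polyOverP Up).
have Up_i := polyOverP Up.
rewrite (placeM plN) ?rpredX // placeX //.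
by rewrite mulr_ile1 ?exprn_ge0 ?exprn_ile1 ?(place_ge0 plN).
Qed.

Lemma place_horner_lip (p : {poly L}) : p \is a polyOver U ->
  exists2 C, 0 <= C & {in U &, forall x y, N x <= 1 -> N y <= 1 ->
    N (p.[x] - p.[y]) <= C * N (x - y)}.
Proof.
move: {2}(size p) (leqnn (size p)) => n.
elim: n p => [|n IHn] p sp Up.
  have ->: p = 0 by apply/eqP; rewrite -size_poly_leq0.
  by exists 0 => // x y _ _ _ _; rewrite !horner0 subr0 place0 mul0r.
pose r := p %/ 'X.
have def_p : p = r * 'X + p.[0]%:P.
  by rewrite {1}(divp_eq p 'X) -[X in p %% X]subr0 -polyC0 modp_XsubC.
have Ur : r \is a polyOver U by rewrite divp_polyOver ?polyOverX.
have sr: (size r <= n)%N by rewrite size_divp ?polyX_eq0 // size_polyX subn1; case: (size p) sp.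
have [C C0 lipr] := IHn r sr Ur; have [B B0 bndr] := place_horner_bound Ur.
exists (C + B) => [|x y Ux Uy Nx Ny]; first exact: addr_ge0.
have Urx: r.[x] \in U by rewrite rpred_horner.
have Ury: r.[y] \in U by rewrite rpred_horner.
have NB: {in U, forall z, 0 <= N z} := place_ge0 plN.
have ->: p.[x] - p.[y] = (r.[x] - r.[y]) * x + r.[y] * (x - y).
  by rewrite def_p !hornerE; ring.
rewrite (le_trans (placeD plN _ _)) ?rpredM ?rpredB // !(placeM plN) ?rpredB //.
have Nxy : 0 <= N (x - y) by rewrite NB ?rpredB.
rewrite mulrDl ge_max; apply/andP; split.
  apply: (@le_trans _ _ (C * N (x - y) * 1)).
    by apply: ler_pM; rewrite ?NB ?rpredB ?lipr.
  by rewrite mulr1 lerDl mulr_ge0.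
apply: (@le_trans _ _ (B * N (x - y))); first by rewrite ler_wpM2r ?bndr.
by rewrite lerDr mulr_ge0.
Qed.

(** Induction on [p] yields an integral [c] directly, without halving a second derivative, which
    could lose integrality at places above 2. *)
Lemma place_taylor (p : {poly L}) x h : p \is a polyOver U ->
  (forall i, N p`_i <= 1) -> x \in U -> N x <= 1 -> h \in U -> N h <= 1 ->
  exists c, [/\ c \in U, N c <= 1 & p.[x + h] = p.[x] + p^`().[x] * h + c * h ^+ 2].
Proof.
move=> Up Np Ux Nx Uh Nh; elim/poly_ind: p Up Np => [|r b IHr] Up Np.
  by exists 0; rewrite mem0v place0 ler01 deriv0 !horner0 !mul0r !addr0.
have Ur: r \is a polyOver U.
  by apply/polyOverP=> i; have := polyOverP Up i.+1; rewrite coefD coefMX coefC /= addr0.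
have Nr i: N r`_i <= 1 by have := Np i.+1; rewrite coefD coefMX coefC /= addr0.
have [c [Uc Nc Ec]] := IHr Ur Nr.
have Udr: r^`() \is a polyOver U by rewrite polyOver_deriv.
have Ndr i: N r^`()`_i <= 1.
  rewrite coef_deriv -mulr_natr (placeM plN) ?rpred_nat ?(polyOverP Ur) //.
  by rewrite mulr_ile1 ?place_nat_le ?(place_ge0 plN) ?rpred_nat ?(polyOverP Ur).
have Urx: r^`().[x] \in U by rewrite rpred_horner.
have Nrx: N r^`().[x] <= 1 by apply: place_horner_int.
exists (c * (x + h) + r^`().[x]); split.
- by rewrite rpredD ?rpredM ?rpredD.
- rewrite (le_trans (placeD plN _ _)) ?rpredM ?rpredD // ge_max Nrx andbT.
  rewrite (placeM plN) ?rpredD // mulr_ile1 ?(place_ge0 plN) ?rpredD //.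
  by rewrite (le_trans (placeD plN _ _)) // ge_max Nx.
rewrite derivD derivM derivX derivC !hornerE Ec /=; ring.
Qed.

(** * Extension of a place along a simple root, by Newton iteration *)

Section Extension.
Variables (alpha a : L).
Let f := minPoly U alpha.
Hypotheses (Nf : forall i, N f`_i <= 1) (Ua : a \in U) (Na : N a <= 1).
Hypotheses (Nfa : N f.[a] < 1) (Ndfa : N f^`().[a] = 1).

Let Uf : f \is a polyOver U := minPolyOver U alpha.
Let Udf : f^`() \is a polyOver U.
Proof. by rewrite polyOver_deriv. Qed.
Let NU := place_ge0 plN.
Let rhoX_ge0 k : 0 <= rho ^+ k.
Proof. by rewrite exprn_ge0 // ltW // place_rho_gt0. Qed.
Let rhoX_le k l : (k <= l)%N -> rho ^+ l <= rho ^+ k.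
Proof.
by move=> lekl; rewrite ler_wiXn2l // ?ltW // ?place_rho_gt0 ?place_rho_lt1.
Qed.

(** Newton's iteration; all iterates lie in [U] and stand in for their limit in a completion. *)
Fixpoint hensel k : L :=
  if k is k'.+1 then hensel k' - f.[hensel k'] / f^`().[hensel k'] else a.

(** The derivative at [u] is a unit, so the step [h] satisfies [N h = N f.[u]] and is too small to
    change the absolute value of the derivative. In Taylor's formula for [f] the terms of order 0
    and 1 cancel, leaving at most [N h ^+ 2]; of this gain only one factor [rho] is recorded. *)
Lemma hensel_props k : [/\ hensel k \in U, N (hensel k) <= 1,
  N f^`().[hensel k] = 1, N f.[hensel k] <= rho ^+ k.+1 & N (hensel k - a) < 1].
Proof.
elim: k => [|k [Uk Nk Ndk Nfk Nka]] /=.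
  split=> //; last by rewrite subrr place0.
  by rewrite expr1 (place_discrete plN) ?rpred_horner.
set u := hensel k in Uk Nk Ndk Nfk Nka *.
have Udu : f^`().[u] \in U by rewrite rpred_horner.
have Ufu : f.[u] \in U by rewrite rpred_horner.
have du0 : f^`().[u] != 0 by rewrite -(place_eq0 plN) // Ndk oner_eq0.
pose h := - (f.[u] / f^`().[u]).
have Uh : h \in U by rewrite rpredN rpred_div.
have Nh_eq : N h = N f.[u].
  by rewrite /h placeN ?rpred_div // (placeM plN) ?rpredV // placeV // Ndk invr1 mulr1.
have Nh : N h <= rho ^+ k.+1 by rewrite Nh_eq.
have rlt1 : rho ^+ k.+1 < 1.
  by rewrite (le_lt_trans (rhoX_le (_ : 1 <= k.+1)%N)) // expr1 place_rho_lt1.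
have Nh1 : N h < 1 by apply: le_lt_trans rlt1.
rewrite -/h; split.
- by rewrite rpredD.
- by rewrite (le_trans (placeD plN _ _)) // ge_max Nk ltW.
- have Ndf i: N f^`()`_i <= 1.
    rewrite coef_deriv -mulr_natr (placeM plN) ?rpred_nat ?(polyOverP Uf) //.
    by rewrite mulr_ile1 ?place_nat_le ?NU ?rpred_nat ?(polyOverP Uf).
  have [c [Uc Nc ->]] := place_taylor Udf Ndf Uk Nk Uh (ltW Nh1).
  have Uddu : f^`()^`().[u] \in U by rewrite rpred_horner ?polyOver_deriv.
  rewrite -addrA expr2 mulrA -mulrDl placeD_eq ?rpredM ?rpredD ?rpredM // Ndk.
  rewrite (placeM plN) ?rpredD ?rpredM // (le_lt_trans _ Nh1) // ler_piMl ?NU //.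
  rewrite (le_trans (placeD plN _ _)) ?rpredM // ge_max.
  rewrite place_horner_int ?polyOver_deriv //= => [|i].
    by rewrite (placeM plN) // mulr_ile1 ?NU // ltW.
  rewrite coef_deriv -mulr_natr (placeM plN) ?rpred_nat ?(polyOverP Udf) //.
  by rewrite mulr_ile1 ?place_nat_le ?NU ?rpred_nat ?(polyOverP Udf).
- have [c [Uc Nc ->]] := place_taylor Uf Nf Uk Nk Uh (ltW Nh1).
  rewrite {1}/h mulrN mulrCA mulfV // mulr1 subrr add0r.
  rewrite (placeM plN) ?rpredX // placeX // -[rho ^+ _]mul1r.
  rewrite ler_pM ?exprn_ge0 ?NU // (@le_trans _ _ (rho ^+ k.+1 ^+ 2)) //.
    by rewrite lerXn2r ?nnegrE ?NU.
  by rewrite -exprM rhoX_le // muln2 -addnn addSn ltnS leq_addl.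
by rewrite addrAC (le_lt_trans (placeD plN _ _)) ?rpredB // gt_max Nka.
Qed.

Lemma hensel_in k : hensel k \in U. Proof. by have [] := hensel_props k. Qed.
Lemma hensel_int k : N (hensel k) <= 1. Proof. by have [] := hensel_props k. Qed.

Lemma hensel_cauchy k l : (k <= l)%N -> N (hensel l - hensel k) <= rho ^+ k.+1.
Proof.
elim: l => [|l IHl]; first by rewrite leqn0 => /eqP->; rewrite subrr place0.
rewrite leq_eqVlt => /predU1P[-> | lekl]; first by rewrite subrr place0.
have [Uk _ _ _ _] := hensel_props k; have [Ul _ Nd Nfl _] := hensel_props l.
have Udu : f^`().[hensel l] \in U by rewrite rpred_horner.
have Ufu : f.[hensel l] \in U by rewrite rpred_horner.
rewrite /= addrAC (le_trans (placeB _ _)) ?rpredB ?rpred_div // ge_max IHl //=.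
rewrite (placeM plN) ?rpredV // placeV // Nd invr1 mulr1 (le_trans Nfl) //.
by rewrite rhoX_le // ltnS.
Qed.

Definition eventually (P : nat -> Prop) := exists k0, forall k, (k0 <= k)%N -> P k.

Lemma eventually_and P1 P2 : eventually P1 -> eventually P2 ->
  eventually (fun k => P1 k /\ P2 k).
Proof.
move=> [k1 P1k] [k2 P2k]; exists (maxn k1 k2) => k.
by rewrite geq_max => /andP[/P1k ? /P2k].
Qed.

(** Such an [s] is a multiple of [f]; the cofactor is bounded on the iterates, where [f] tends to
    0. *)
Lemma hensel_root_small (s : {poly L}) e : s \is a polyOver U -> s.[alpha] = 0 -> 0 < e ->
  eventually (fun k => N s.[hensel k] < e).
Proof.
move=> Us s0 e0.
have def_s : s %/ f * f = s by apply/divpK/minPoly_dvdp => //; apply/rootP.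
have Ur : s %/ f \is a polyOver U by rewrite divp_polyOver.
have [B B0 bnd] := place_horner_bound Ur.
have [k0 small] := rho_pow_small B e0; exists k0 => k lek.
have [Uk Nk _ Nfk _] := hensel_props k.
rewrite -def_s hornerM (placeM plN) ?rpred_horner //.
apply: le_lt_trans (small k.+1 (leqW lek)).
by rewrite ler_pM ?NU ?rpred_horner ?bnd.
Qed.

(** The inverse of [s.[alpha]] is a polynomial [v1] in [alpha], and [v1 * s] tends to 1 along the
    iterates; this bounds [N s.[hensel k]] away from 0. The values [s.[hensel k]] also form a Cauchy
    sequence, so by the ultrametric inequality their absolute value is eventually constant. *)
Lemma hensel_stable (s : {poly L}) : s \is a polyOver U -> s.[alpha] != 0 ->
  exists2 r, 0 < r & eventually (fun k => N s.[hensel k] = r).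
Proof.
move=> Us s0.
have Us_k k : s.[hensel k] \in U by rewrite rpred_horner ?hensel_in.
have [d d0 lb] : exists2 d, 0 < d & eventually (fun k => d <= N s.[hensel k]).
  pose v1 := (Fadjoin_poly U alpha s.[alpha]^-1).
  have Uv1 : v1 \is a polyOver U := Fadjoin_polyOver _ _ _.
  have v1s : (v1 * s - 1).[alpha] = 0.
    rewrite !hornerE Fadjoin_poly_eq ?mulVf ?subrr // rpredV.
    by rewrite mempx_Fadjoin.
  have [k0 Hk0] := hensel_root_small (rpredB (rpredM Uv1 Us) (rpred1 _)) v1s ltr01.
  have [B B0 bnd] := place_horner_bound Uv1.
  (* Adding 1 keeps the bound invertible when [B] is 0. *)
  exists (B + 1)^-1; first by rewrite invr_gt0 ltr_wpDl.
  exists k0 => k /Hk0; rewrite !hornerE => Nk.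
  have Uv1k : v1.[hensel k] \in U by rewrite rpred_horner ?hensel_in.
  have : N (v1.[hensel k] * s.[hensel k]) = 1.
    rewrite -[v1.[_] * _](subrK 1) addrC placeD_eq ?mem1v ?place1 //.
    by rewrite rpredB ?mem1v ?rpredM.
  rewrite (placeM plN) // => E1.
  have Bk := bnd _ (hensel_in k) (hensel_int k).
  rewrite -[_^-1]mulr1 ler_pdivrMl ?ltr_wpDl // -{1}E1 ler_wpM2r ?NU //.
  by rewrite (le_trans Bk) // lerDl.
have [C C0 lip] := place_horner_lip Us.
have [k1 Hk1] := lb; have [k2 Hk2] := rho_pow_small C d0.
pose k0 := maxn k1 k2.
exists (N s.[hensel k0]); first by rewrite (lt_le_trans d0) // Hk1 // leq_maxl.
exists k0 => k lek; rewrite -[s.[hensel k]](subrK s.[hensel k0]) addrC.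
rewrite placeD_eq ?rpredB //.
apply: lt_le_trans (Hk1 k0 (leq_maxl _ _)).
apply: le_lt_trans (Hk2 k0.+1 _); last by rewrite leqW // leq_maxr.
apply: le_trans (lip _ _ (hensel_in _) (hensel_in _) (hensel_int _) (hensel_int _)) _.
by rewrite ler_wpM2l ?hensel_cauchy.
Qed.

Definition ext_norm (x : L) : rat :=
  if x == 0 then 0 else
  epsilon (inhabits 0)
    (fun r => eventually (fun k => N (Fadjoin_poly U alpha x).[hensel k] = r)).

(** Independence of the representing polynomial: two choices differ by a polynomial vanishing at
    [alpha], whose values at late iterates are smaller than [r]. *)
Lemma ext_normE (s : {poly L}) : s \is a polyOver U -> s.[alpha] != 0 ->
  0 < ext_norm s.[alpha] /\ eventually (fun k => N s.[hensel k] = ext_norm s.[alpha]).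
Proof.
move=> Us s0; have [r r0 evr] := hensel_stable Us s0.
rewrite /ext_norm (negPf s0); set s1 := Fadjoin_poly _ _ _.
have Us1 : s1 \is a polyOver U := Fadjoin_polyOver _ _ _.
have evr1 : eventually (fun k => N s1.[hensel k] = r).
  have s1s : (s1 - s).[alpha] = 0.
    by rewrite hornerD hornerN Fadjoin_poly_eq ?mempx_Fadjoin ?subrr.
  have [k0 Hk0] := eventually_and evr (hensel_root_small (rpredB Us1 Us) s1s r0).
  exists k0 => k /Hk0[Er]; rewrite hornerD hornerN => ltr.
  rewrite -[s1.[_]](subrK s.[hensel k]) addrC placeD_eq ?Er //.
    by rewrite rpred_horner ?hensel_in.
  by rewrite rpredB ?rpred_horner ?hensel_in.
set P := (X in epsilon _ X); have := epsilon_spec (inhabits 0) P (ex_intro P r evr1).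
set r1 := epsilon _ _ => evr1'.
suffices -> : r1 = r by [].
have [k0 Hk0] := eventually_and evr1 evr1'.
by have [<- ->] := Hk0 k0 (leqnn _).
Qed.

Lemma ext_norm_le (s : {poly L}) b : s \is a polyOver U -> 0 <= b ->
  eventually (fun k => N s.[hensel k] <= b) -> ext_norm s.[alpha] <= b.
Proof.
move=> Us b0 evb; have [s0 | s0] := eqVneq s.[alpha] 0.
  by rewrite /ext_norm s0 eqxx.
have [_ ev] := ext_normE Us s0; have [k0 /(_ k0 (leqnn _))[]] := eventually_and ev evb.
by move=> ->.
Qed.

Lemma ext_norm_lt (s : {poly L}) b : s \is a polyOver U -> 0 < b ->
  eventually (fun k => N s.[hensel k] < b) -> ext_norm s.[alpha] < b.
Proof.
move=> Us b0 evb; have [s0 | s0] := eqVneq s.[alpha] 0.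
  by rewrite /ext_norm s0 eqxx.
have [_ ev] := ext_normE Us s0; have [k0 /(_ k0 (leqnn _))[]] := eventually_and ev evb.
by move=> ->.
Qed.

(** Each property of the new absolute value is read off from [N] at a late enough iterate. The third
    clause, witnessed by [s.[hensel k0]], says that [U] is dense: the new place has degree one over
    the old one. *)
Theorem place_extension : exists N' : L -> rat,
  [/\ place <<U; alpha>> q N',
      {in U, forall x, N' x = N x},
      forall x e, x \in <<U; alpha>>%VS -> 0 < e -> exists2 y, y \in U & N' (x - y) < e
    & N' (alpha - a) < 1].
Proof.
have N'U : {in U, forall x, ext_norm x = N x}.
  move=> x Ux; have [-> | x0] := eqVneq x 0; first by rewrite /ext_norm eqxx place0.
  have Us : x%:P \is a polyOver U by rewrite polyOverC.
  have [|_ [k0 /(_ k0 (leqnn _))]] := ext_normE Us; first by rewrite hornerC.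
  by rewrite !hornerC => ->.
have ge0 x : x \in <<U; alpha>>%VS -> 0 <= ext_norm x.
  move/Fadjoin_polyP=> [s Us ->]; have [-> | s0] := eqVneq s.[alpha] 0.
    by rewrite /ext_norm eqxx.
  by have [/ltW] := ext_normE Us s0.
exists ext_norm; split=> //; last 2 first.
- move=> _ e /Fadjoin_polyP[s Us ->] e0.
  have [C C0 lip] := place_horner_lip Us.
  have [k0 Hk0] := rho_pow_small C e0.
  have Uk : s.[hensel k0] \in U by rewrite rpred_horner ?hensel_in.
  exists s.[hensel k0] => //.
  have := @ext_norm_lt (s - s.[hensel k0]%:P) e.
  rewrite hornerD hornerN hornerC; apply=> //; first by rewrite rpredB ?polyOverC.
  exists k0 => k lek; rewrite hornerD hornerN hornerC.
  apply: le_lt_trans (Hk0 k0.+1 (leqW (leqnn _))).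
  apply: le_trans (lip _ _ (hensel_in _) (hensel_in _) (hensel_int _) (hensel_int _)) _.
  by rewrite ler_wpM2l ?hensel_cauchy.
- have := @ext_norm_lt ('X - a%:P) 1; rewrite hornerXsubC; apply=> //.
    by rewrite polyOverXsubC.
  by exists 0 => k _; rewrite hornerXsubC; have [] := hensel_props k.
split=> //.
- exact: place_gt1 plN.
- move=> x /Fadjoin_polyP[s Us ->]; have [-> | s0] := eqVneq s.[alpha] 0.
    by rewrite /ext_norm eqxx.
  by have [/gt_eqF] := ext_normE Us s0.
- move=> _ _ /Fadjoin_polyP[s Us ->] /Fadjoin_polyP[t Ut ->].
  have [-> | s0] := eqVneq s.[alpha] 0; first by rewrite mul0r /ext_norm eqxx mul0r.
  have [-> | t0] := eqVneq t.[alpha] 0; first by rewrite mulr0 /ext_norm eqxx mulr0.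
  have [_ evs] := ext_normE Us s0; have [_ evt] := ext_normE Ut t0.
  have st0 : (s * t).[alpha] != 0 by rewrite hornerM mulf_neq0.
  have [_ evst] := ext_normE (rpredM Us Ut) st0.
  have [k0 /(_ k0 (leqnn _))[[<- <-]]] := eventually_and (eventually_and evs evt) evst.
  by rewrite !hornerM => <-; rewrite (placeM plN) ?rpred_horner ?hensel_in.
- move=> _ _ /Fadjoin_polyP[s Us ->] /Fadjoin_polyP[t Ut ->].
  have [-> | s0] := eqVneq s.[alpha] 0; first by rewrite add0r le_max lexx orbT.
  have [-> | t0] := eqVneq t.[alpha] 0; first by rewrite addr0 le_max lexx.
  have [ps evs] := ext_normE Us s0; have [_ evt] := ext_normE Ut t0.
  rewrite -hornerD ext_norm_le ?rpredD //; first by rewrite le_max ltW.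
  have [k0 Hk0] := eventually_and evs evt; exists k0 => k /Hk0[<- <-].
  by rewrite hornerD (placeD plN) ?rpred_horner ?hensel_in.
- by rewrite N'U ?rpred_nat // (place_unif plN).
move=> _ /Fadjoin_polyP[s Us ->].
have [-> _ | s0] := eqVneq s.[alpha] 0.
  by rewrite /ext_norm eqxx invr_ge0 ler0n.
have [_ [k0 /(_ k0 (leqnn _)) <-]] := ext_normE Us s0.
by apply: (place_discrete plN); rewrite rpred_horner ?hensel_in.
Qed.
End Extension.
End Place.

(** * Places of number fields *)

(** By convention [logn q 0] is 0, hence the separate case. *)
Definition padic_int (q : nat) (a : int) : rat :=
  if a == 0 then 0 else q%:R ^- logn q `|a|.

Definition padic (q : nat) (x : rat) : rat :=
  padic_int q (numq x) / padic_int q (denq x).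

Section Padic.
Variable q : nat.
Hypothesis q_pr : prime q.

Let q_gt0 : 0 < (q%:R : rat). Proof. by rewrite ltr0n prime_gt0. Qed.

Lemma padic_int_eq0 a : (padic_int q a == 0) = (a == 0).
Proof.
rewrite /padic_int; case: ifP => // _.
by rewrite invr_eq0 expf_eq0 gt_eqF // andbF.
Qed.

Lemma padic_int_ge0 a : 0 <= padic_int q a.
Proof. by rewrite /padic_int; case: ifP => // _; rewrite invr_ge0 exprn_ge0 // ltW. Qed.

Lemma padic_intM : {morph padic_int q : a b / a * b}.
Proof.
move=> a b; rewrite /padic_int mulf_eq0; case: eqVneq => [_|a0] /=; first by rewrite mul0r.
case: eqVneq => [_|b0]; first by rewrite mulr0.
by rewrite abszM lognM ?absz_gt0 // exprD invfM mulrC.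
Qed.

Lemma padic_int_le (n : nat) a : (padic_int q a <= q%:R ^- n) = (q ^ n %| `|a|)%N.
Proof.
rewrite /padic_int; case: eqVneq => [->|a0].
  by rewrite dvdn0 invr_ge0 exprn_ge0 // ltW.
rewrite lef_pV2 ?posrE ?exprn_gt0 // ler_eXn2l ?ltr1n ?prime_gt1 //.
by rewrite pfactor_dvdn // absz_gt0.
Qed.

Lemma padic_intD a b : padic_int q (a + b) <= Num.max (padic_int q a) (padic_int q b).
Proof.
wlog leab : a b / padic_int q a <= padic_int q b.
  move=> wl; have /orP[/wl // | /wl] := le_total (padic_int q a) (padic_int q b).
  by rewrite addrC maxC.
rewrite max_r //; have [b0 | b0] := eqVneq b 0.
  by move: leab; rewrite b0 addr0.
have Eb : padic_int q b = q%:R ^- logn q `|b| by rewrite /padic_int (negPf b0).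
move: leab; rewrite Eb !padic_int_le => da.
have := pfactor_dvdnn q `|b|; move: da.
set d := (q ^ _)%N => da db.
suff : (d%:Z %| a + b)%Z by [].
by rewrite rpredD.
Qed.

Lemma padicE a b : b != 0 -> padic q (a%:~R / b%:~R) = padic_int q a / padic_int q b.
Proof.
move=> b0; set x := a%:~R / _; rewrite /padic.
apply/eqP; rewrite eqr_div ?padic_int_eq0 // -!padic_intM; apply/eqP.
congr (padic_int q _); apply/eqP; rewrite -(eqr_int rat) !rmorphM /=.
rewrite -eqr_div ?intr_eq0 //; exact/eqP/divq_num_den.
Qed.

Lemma padic_of_int a : padic q a%:~R = padic_int q a.
Proof.
by rewrite -[a%:~R]divr1 -[1]/(1%:~R) padicE // {2}/padic_int /= logn1 expr0 invr1 divr1.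
Qed.

Lemma padic_eq0 x : (padic q x == 0) = (x == 0).
Proof.
by rewrite /padic mulf_eq0 invr_eq0 !padic_int_eq0 numq_eq0 (negPf (denq_neq0 x)) orbF.
Qed.

Lemma padic_ge0 x : 0 <= padic q x.
Proof. by rewrite divr_ge0 ?padic_int_ge0. Qed.

Lemma padicM : {morph padic q : x y / x * y}.
Proof.
move=> x y; rewrite -{1}[x]divq_num_den -{1}[y]divq_num_den mulf_div -!rmorphM /=.
by rewrite padicE ?mulf_neq0 ?denq_neq0 // !padic_intM -mulf_div.
Qed.

Lemma padicD x y : padic q (x + y) <= Num.max (padic q x) (padic q y).
Proof.
have [dx dy] := (denq_neq0 x, denq_neq0 y).
have nz z : padic_int q (denq z) != 0 by rewrite padic_int_eq0 denq_neq0.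
have pos z : 0 < padic_int q (denq z) by rewrite lt_def nz padic_int_ge0.
rewrite -{1}[x]divq_num_den -{1}[y]divq_num_den addf_div ?intr_eq0 //.
rewrite -!rmorphM -rmorphD /= padicE ?mulf_neq0 // ler_pdivrMr ?padic_intM;
  last by rewrite mulr_gt0 ?(pos x) ?(pos y).
apply: le_trans (padic_intD _ _) _; rewrite !padic_intM /padic.
set u := padic_int q (numq x); set v := padic_int q (numq y).
set d := padic_int q (denq x); set e := padic_int q (denq y).
have -> : u * e = u / d * (d * e) by rewrite mulrA divfK ?nz.
have -> : v * d = v / e * (d * e) by rewrite [d * e]mulrC mulrA divfK ?nz.
by rewrite maxr_pMl ?mulr_ge0 ?padic_int_ge0.
Qed.

Lemma padic_discrete x : padic q x < 1 -> padic q x <= q%:R^-1.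
Proof.
have [-> | x0] := eqVneq x 0.
  by rewrite (eqP (_ : padic q 0 == 0)) ?padic_eq0 // invr_ge0 ltW.
rewrite /padic /padic_int numq_eq0 (negPf x0) (negPf (denq_neq0 x)) invrK.
move: (logn _ _) (logn _ _) => i j.
rewrite mulrC -ltr_pdivlMr ?invr_gt0 ?exprn_gt0 // mul1r invrK.
rewrite ltr_eXn2l ?ltr1n ?prime_gt1 // => ltji.
rewrite ler_pdivrMr ?exprn_gt0 // -ler_pdivrMl ?invr_gt0 // invrK -exprS.
by rewrite ler_eXn2l ?ltr1n ?prime_gt1.
Qed.

Lemma padic_int_le1 a : padic_int q a <= 1.
Proof. by have := padic_int_le 0 a; rewrite invr1 dvd1n. Qed.

Lemma padic_int_lt1 a : (padic_int q a < 1) = (q %| `|a|)%N.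
Proof.
rewrite -[q in RHS]expn1 -padic_int_le expr1; apply/idP/idP => [|le].
  by rewrite -padic_of_int; apply: padic_discrete.
by rewrite (le_lt_trans le) // invf_lt1 // ltr1n prime_gt1.
Qed.

Lemma padic_int_eq1 a : (padic_int q a == 1) = ~~ (q %| `|a|)%N.
Proof. by rewrite -padic_int_lt1 lt_neqAle padic_int_le1 andbT negbK. Qed.

End Padic.

(** * Roots of rational polynomials modulo primes *)

Lemma rat_poly_int (p : {poly rat}) : exists2 D : nat, (0 < D)%N &
  exists p1 : {poly int}, map_poly intr p1 = D%:R *: p.
Proof.
have [p1 [a a0 Ep]] := rat_poly_scale p.
exists `|a|%N; first by rewrite absz_gt0.
exists (sgz a *: p1); rewrite Ep scalerA map_polyZ /=; congr (_ *: _).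
by rewrite [RHS](_ : _ = (`|a|%N%:Z)%:~R / a%:~R) // abszEsg rmorphM mulfK ?intr_eq0.
Qed.

(** The bad primes are recorded as divisors of one integer, so that several such conditions combine
    by multiplication. *)
Lemma den_poly (p : {poly rat}) : exists2 D : nat, (0 < D)%N &
  forall q, prime q -> ~~ (q %| D)%N -> forall i, padic q p`_i <= 1.
Proof.
have [D D0 [p1 Ep]] := rat_poly_int p; exists D => // q pr_q qD i.
have := congr1 (fun r : {poly rat} => padic q r`_i) Ep.
rewrite coef_map coefZ padicM // padic_of_int // -[D%:R]/(D%:Z%:~R) padic_of_int //.
have /eqP -> : padic_int q D == 1 by rewrite padic_int_eq1.
by rewrite mul1r => <-; apply: padic_int_le1.
Qed.

(** Schur's variant of Euclid's argument. Once denominators are cleared and [c] is the constant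
    term, the value at a multiple of [D * D1 * c] is [c * z] with [z] prime to [D * D1], and any
    prime factor of [z] serves. If [c = 0], the root 0 and any prime above [D] do. *)
Lemma exists_mod_root (p : {poly rat}) (D : nat) : (1 < size p)%N -> (0 < D)%N ->
  exists q a, [/\ prime q, ~~ (q %| D)%N & padic q p.[a%:~R] < 1].
Proof.
move=> sp D0; have [D1 D10 [p1 Ep]] := rat_poly_int p.
have [c0 | c0] := eqVneq p1`_0 0.
  have [q ltq pr_q] := prime_above D; exists q, 0; split=> //.
    by apply: contraL ltq => /(dvdn_leq D0); rewrite leqNgt.
  have /eqP := congr1 (fun r : {poly rat} => r`_0) Ep.
  rewrite coef_map c0 coefZ eq_sym mulf_eq0 pnatr_eq0 -leqn0 leqNgt D10 /=.
  by move/eqP; rewrite horner_coef0 => ->; rewrite (eqP (_ : padic q 0 == 0)) ?padic_eq0.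
set c := p1`_0 in c0; pose d := (D * D1)%:Z * c.
have d0 : d != 0 by rewrite mulf_neq0 // eqz_nat muln_eq0 negb_or -!lt0n D0.
pose r := p1 \Po (d *: 'X).
have sp1 : (1 < size p1)%N.
  rewrite -(size_map_inj_poly (@intr_inj rat) (rmorph0 _)) Ep size_scale //.
  by rewrite pnatr_eq0 -lt0n.
have sr : (1 < size r)%N by rewrite size_comp_poly2 // size_scale ?size_polyX.
have r0 : r != 0 by rewrite -size_poly_gt0 ltnW.
(* Where [w] does not vanish, [r] takes none of the values 0, [c] and [- c]. *)
pose w := r * (r ^+ 2 - (c ^+ 2)%:P).
have w0 : w != 0.
  rewrite mulf_neq0 // subr_eq0; apply: contraTneq sr => E.
  have := congr1 (fun r : {poly int} => size r) E.
  have /= := size_exp r 2; rewrite E size_polyC sqrf_eq0 c0 /=.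
  by case: (size r) => [|[|n]] //.
(* [z = p1(d y) / c] is congruent to 1 modulo [D * D1], and the choice of [y]
   makes it different from 0, 1 and -1. *)
have [y wy] : exists y : nat, w.[y%:Z] != 0.
  pose ys := [seq y%:Z | y <- iota 0 (size w)].
  have uys : uniq ys by rewrite map_inj_uniq ?iota_uniq // => i j [].
  have [allw | /allPn[_ /mapP[y _ ->] wy]] := boolP (all (root w) ys); last by exists y.
  by have := max_poly_roots w0 allw uys; rewrite size_map size_iota ltnn.
have /factor_theorem[k Ek] : root (p1 - c%:P) 0.
  by rewrite rootE hornerD hornerN hornerC horner_coef0 subrr.
pose z := 1 + (D * D1)%:Z * (y%:Z * k.[d * y%:Z]).
have rz : r.[y%:Z] = c * z.
  have : (p1 - c%:P).[d * y%:Z] = k.[d * y%:Z] * (d * y%:Z) by rewrite Ek hornerM hornerXsubC subr0.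
  rewrite hornerD hornerN hornerC => /eqP; rewrite subr_eq => /eqP.
  by rewrite horner_comp hornerZ hornerX => ->; rewrite /z /d; ring.
have z1 : (1 < `|z|)%N.
  move: wy; rewrite hornerM hornerD hornerN hornerC !horner_exp rz exprMn.
  rewrite -{2}[c ^+ 2]mulr1 -mulrBr !mulf_eq0 subr_eq0 sqrf_eq1.
  by rewrite !negb_or => /andP[/andP[_ z0] /and3P[_ zp zn]]; lia.
have pr_q := pdiv_prime z1; set q := pdiv _ in pr_q.
have qz : (q %| `|z|)%N := pdiv_dvd _.
have qDD : ~~ (q %| D * D1)%N.
  apply/negP => qD.
  pose e := z - (D * D1)%:Z * (y%:Z * k.[d * y%:Z]).
  have : (q%:Z %| e)%Z by rewrite rpredB // dvdz_mulr.
  rewrite /e /z addrK.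
  by rewrite dvdzE absz1 dvdn1 /= => /eqP q1; have := prime_gt1 pr_q; rewrite q1.
exists q, (d * y%:Z); split=> //; first by apply: contra qDD => /dvdn_mulr ->.
have := congr1 (fun r : {poly rat} => padic q r.[(d * y%:Z)%:~R]) Ep.
rewrite horner_map hornerZ padicM // padic_of_int // -[D1%:R]/(D1%:Z%:~R) padic_of_int //.
have /eqP -> : padic_int q D1 == 1.
  by rewrite padic_int_eq1 //; apply: contra qDD => /dvdn_mull ->.
rewrite mul1r => <-; rewrite padic_int_lt1 //.
have -> : p1.[d * y%:Z] = c * z by rewrite -rz horner_comp !hornerE.
by rewrite abszM dvdn_mull.
Qed.

(** * Places of degree one with prescribed units *)

Section NumberFieldPlace.
Variable E : fieldExtType rat.

Definition padic_base (q : nat) (x : E) : rat :=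
  padic q (epsilon (inhabits 0) (fun c : rat => x = c%:A)).

Lemma padic_baseE q c : padic_base q c%:A = padic q c.
Proof.
rewrite /padic_base; set P := (X in epsilon _ X).
have := epsilon_spec (inhabits 0) P (ex_intro P c erefl).
by rewrite /P => /(fmorph_inj (in_alg E)) <-.
Qed.

Lemma place_padic_base q : prime q -> place (1%VS : {vspace E}) q (padic_base q).
Proof.
move=> pr_q; split; first exact: prime_gt1.
- by move=> _ /vlineP[c ->]; rewrite padic_baseE padic_ge0.
- move=> _ /vlineP[c ->]; rewrite padic_baseE padic_eq0 //.
  by rewrite scaler_eq0 oner_eq0 orbF.
- move=> _ _ /vlineP[c ->] /vlineP[d ->]; rewrite -(rmorphM (in_alg E)) /=.
  by rewrite !padic_baseE padicM.
- move=> _ _ /vlineP[c ->] /vlineP[d ->]; rewrite -(rmorphD (in_alg E)) /=.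
  by rewrite !padic_baseE padicD.
- rewrite -scaler_nat padic_baseE -[q%:R]/(q%:Z%:~R) padic_of_int // /padic_int.
  by rewrite eqz_nat gtn_eqF ?prime_gt0 //= logn_prime // eqxx.
by move=> _ /vlineP[c ->]; rewrite padic_baseE; apply: padic_discrete.
Qed.

Local Notation "p ^A" := (map_poly (in_alg E) p) (at level 2, format "p ^A").

Lemma separable_rat (K V : {subfield E}) : separable K V.
Proof.
by apply/separableP=> x _; apply: pcharf0_separable => p; rewrite pchar_lalg pchar_num.
Qed.

Lemma full_adjoin : exists theta : E, <<1; theta>>%VS = fullv.
Proof.
exists (separable_generator 1 {:E}).
by rewrite -eq_adjoin_separable_generator ?sub1v ?separable_rat.
Qed.

(** Let [P] be the minimal polynomial over Q of a generator [theta]. The prime [q] is one modulo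
    which [P] has a root, prime to the denominators of [P], of the Bezout coefficients of [P] and
    its derivative, and of the elements of [S] and their inverses written in [theta]. Bezout makes
    the root simple, so the q-adic place extends; integrality of [x] and [x^-1] makes [x] a unit. *)
Theorem exists_place (S : seq E) : 0 \notin S -> exists q N,
  [/\ prime q, place {:E} q N, {in S, forall x, N x = 1}
    & forall x e, 0 < e -> exists c : rat, N (x - c%:A) < e].
Proof.
move=> S0; have [theta genE] := full_adjoin.
have /polyOver1P[P EP] := minPolyOver 1 theta.
have polyE x : exists s : {poly rat}, x = s^A.[theta].
  by apply/Fadjoin1_polyP; rewrite genE memvf.
have sep : coprimep P P^`().
  have : separable_poly (minPoly 1 theta).
    by apply: (separableP (separable_rat 1 {:E})); rewrite memvf.
  rewrite EP separable_map unlock //.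
have /Bezout_eq1_coprimepP[[u w] /= Euw] := sep.
have [D1 D10 D1P] : exists2 D, (0 < D)%N & forall q, prime q -> ~~ (q %| D)%N ->
    {in S, forall x, exists s t : {poly rat},
      [/\ x = s^A.[theta], x^-1 = t^A.[theta],
          forall i, padic q s`_i <= 1 & forall i, padic q t`_i <= 1]}.
  elim: S {S0} => [|x S [D D0 IHS]]; first by exists 1.
  have [s Es] := polyE x; have [t Et] := polyE x^-1.
  have [Ds Ds0 Is] := den_poly s; have [Dt Dt0 It] := den_poly t.
  exists (D * (Ds * Dt))%N; first by rewrite !muln_gt0 D0 Ds0.
  move=> q pr_q; rewrite !Euclid_dvdM // !negb_or => /and3P[qD qDs qDt] y.
  rewrite inE => /predU1P[-> | Sy]; last exact: IHS.
  by exists s, t; split=> // i; [apply: Is | apply: It].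
have [DP DP0 IP] := den_poly P.
have [Du Du0 Iu] := den_poly u; have [Dw Dw0 Iw] := den_poly w.
have sP : (1 < size P)%N.
  by rewrite -(size_map_poly (in_alg E)) -EP size_minPoly.
have Dgt0 : (0 < D1 * (DP * (Du * Dw)))%N by rewrite !muln_gt0 D10 DP0 Du0.
have [q [a [pr_q]]] := exists_mod_root sP Dgt0.
rewrite !Euclid_dvdM // !negb_or => /and4P[qD1 qDP qDu qDw] Pa.
have plN := place_padic_base pr_q; set N := padic_base q in plN.
have Npoly (p : {poly rat}) : (forall i, padic q p`_i <= 1) ->
    p^A \is a polyOver 1%VS /\ forall i, N p^A`_i <= 1.
  move=> Ip; split=> [|i]; first exact: alg_polyOver.
  by rewrite coef_map /= /N padic_baseE.
pose b : E := a%:~R%:A.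
have Ub : b \in 1%VS by rewrite rpredZ // mem1v.
have Nb : N b <= 1 by rewrite /N padic_baseE padic_of_int // padic_int_le1.
have horner_b p : p^A.[b] = p.[a%:~R]%:A by rewrite /b -[_%:A]/(in_alg E _) horner_map.
have [UP NP] := Npoly _ (IP q pr_q qDP).
have [Uu Nu] := Npoly _ (Iu q pr_q qDu); have [Uw Nw] := Npoly _ (Iw q pr_q qDw).
have NPb : N P^A.[b] < 1 by rewrite horner_b /N padic_baseE.
have NdPi i : N P^A^`()`_i <= 1.
  rewrite coef_deriv -mulr_natr (placeM plN) ?rpred_nat ?(polyOverP UP) //.
  rewrite mulr_ile1 ?(place_nat_le plN) ?(place_ge0 plN) ?rpred_nat //.
  exact: (polyOverP UP).
have UdP : P^A^`() \is a polyOver 1%AS by rewrite polyOver_deriv.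
have NdP : N P^A^`().[b] = 1.
  have NU := place_ge0 plN.
  have U1 (p : {poly E}) : p \is a polyOver 1%VS -> p.[b] \in 1%VS.
    by move=> Up; rewrite (rpred_horner (S := (1%AS : {subfield E}))).
  have [U1u U1w U1P U1dP] := And4 (U1 _ Uu) (U1 _ Uw) (U1 _ UP) (U1 _ UdP).
  have [Nub Nwb] := (place_horner_int plN Uu Nu Ub Nb, place_horner_int plN Uw Nw Ub Nb).
  have NdPb := place_horner_int plN UdP NdPi Ub Nb.
  have E1 : N (w^A.[b] * P^A^`().[b]) = 1.
    have := congr1 (fun p : {poly rat} => p^A.[b]) Euw.
    rewrite rmorphD !rmorphM /= -deriv_map rmorph1 !hornerE => Eb.
    have -> : w^A.[b] * P^A^`().[b] = 1 - u^A.[b] * P^A.[b] by rewrite -Eb addrC addKr.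
    rewrite (placeD_eq plN) ?rpredN ?rpredM ?mem1v ?(place1 plN) //.
    rewrite (placeN plN) ?rpredM // (placeM plN) // (le_lt_trans _ NPb) //.
    by rewrite ler_piMl ?NU.
  apply/eqP; rewrite eq_le NdPb -E1 (placeM plN) //=.
  by rewrite ler_piMl ?NU.
have fE : minPoly (1%AS : {subfield E}) theta = P^A by rewrite -EP.
have := @place_extension _ _ 1%AS q N plN theta b.
rewrite fE => /(_ NP Ub Nb NPb NdP) [N' [plN' N'N dens close]].
have plNE : place (fullv : {vspace E}) q N' by move: plN'; rewrite genE.
exists q, N'; split=> //.
- move=> x Sx; have [s [t [Es Et Is It]]] := D1P q pr_q qD1 x Sx.
  have Nth : N' theta <= 1.
    rewrite -[theta](subrK b) (le_trans (placeD plNE _ _)) ?memvf // ge_max.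
    by rewrite ltW // N'N.
  have le1 (p : {poly rat}) : (forall i, padic q p`_i <= 1) -> N' p^A.[theta] <= 1.
    move=> /Npoly[Up Np]; apply: (place_horner_int plNE); rewrite ?memvf //.
      by apply/polyOverP=> i; rewrite memvf.
    by move=> i; rewrite N'N // (polyOverP Up).
  have x0 : x != 0 by apply: contraNneq S0 => <-.
  have := le1 _ It; rewrite -Et (placeV plNE) ?memvf // => Nx1.
  have Nx0 : 0 < N' x by rewrite (place_gt0 plNE) ?memvf.
  apply/eqP; rewrite eq_le {1}Es le1 //=.
  by rewrite -invf_le1.
move=> x e e0; have [|_ /vlineP[c ->] lt_e] := dens x e _ e0; first by rewrite genE memvf.
by exists c.
Qed.
End NumberFieldPlace.

(** * Splitting fields and abelian extensions *)

(** The map sends [s(theta)] to [s(theta')]; two choices of [s] differ by a multiple of [P]. *)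
Lemma ahom_of_root (F : fieldType) (E E' : fieldExtType F) (theta : E) (theta' : E')
    (P : {poly F}) :
  <<1; theta>>%VS = fullv -> minPoly 1 theta = map_poly (in_alg E) P ->
  root (map_poly (in_alg E') P) theta' -> inhabited 'AHom(E, E').
Proof.
move=> genE EP Pth'.
have polyE x : exists s : {poly F}, x == (map_poly (in_alg E) s).[theta].
  have /Fadjoin1_polyP[s ->] : x \in <<1; theta>>%VS by rewrite genE memvf.
  by exists s.
pose pol x := xchoose (polyE x).
pose g x := (map_poly (in_alg E') (pol x)).[theta'].
have gE s : g (map_poly (in_alg E) s).[theta] = (map_poly (in_alg E') s).[theta'].
  rewrite /g; set x := _.[theta]; have /eqP Ex := xchooseP (polyE x).
  apply/eqP; rewrite -subr_eq0 -hornerN -hornerD -rmorphB.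
  have : map_poly (in_alg E) P %| map_poly (in_alg E) (pol x - s).
    rewrite -EP minPoly_dvdp ?alg_polyOver //.
    by rewrite rootE rmorphB hornerD hornerN -Ex subrr.
  rewrite dvdp_map => /dvdpP[k ->]; rewrite rmorphM hornerM /=.
  by rewrite (rootP Pth') mulr0.
have rep x : exists s, x = (map_poly (in_alg E) s).[theta].
  by exists (pol x); apply/eqP/(xchooseP (polyE x)).
have g_lin : linear g.
  move=> a x y; have [[s ->] [t ->]] := (rep x, rep y).
  have -> : a *: (map_poly (in_alg E) s).[theta] + (map_poly (in_alg E) t).[theta]
     = (map_poly (in_alg E) (a *: s + t)).[theta].
    by rewrite rmorphD /= map_polyZ /= hornerD hornerZ mulr_algl.
  by rewrite !gE rmorphD /= map_polyZ /= hornerD hornerZ mulr_algl.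
have g_mul : {morph g : x y / x * y}.
  move=> x y; have [[s ->] [t ->]] := (rep x, rep y).
  by rewrite -hornerM -rmorphM !gE rmorphM hornerM.
have g1 : g 1 = 1.
  have -> : 1 = (map_poly (in_alg E) 1).[theta] by rewrite rmorph1 hornerC.
  by rewrite gE rmorph1 hornerC.
pose gL : {linear E -> E'} := HB.pack g (GRing.isLinear.Build _ _ _ _ g g_lin).
have gh : ahom_in {:E} (linfun gL).
  apply/ahom_inP; split=> [x y _ _|]; rewrite !lfunE //; exact: g_mul.
exact: (inhabits (AHom gh)).
Qed.

(** [E'] is generated by the roots in [algC] of [P * p], with [P] the minimal polynomial of a
    generator of [E]; a root of [P] in it gives the embedding of [E]. The embedding into [algC] is
    kept for the use of cyclotomic polynomials. *)
Lemma splitting_extension (E : fieldExtType rat) (p : {poly rat}) : p != 0 ->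
  exists (E' : splittingFieldType rat) (f : 'AHom(E, E')) (rs : seq E'),
    map_poly (in_alg E') p %= \prod_(z <- rs) ('X - z%:P)
    /\ inhabited {rmorphism E' -> algC}.
Proof.
move=> p0; have [theta genE] := full_adjoin E.
have /polyOver1P[P EP] := minPolyOver 1 theta.
have P0 : P != 0 by rewrite -(map_poly_eq0 (in_alg E)) -EP monic_neq0 ?monic_minPoly.
have sP : (1 < size P)%N by rewrite -(size_map_poly (in_alg E)) -EP size_minPoly.
have Pp0 : P * p != 0 by rewrite mulf_neq0.
have [s Es] := closed_field_poly_normal (map_poly (ratr : rat -> algC) (P * p)).
have [Qs [QsC [s1 Es1 gens1]]] := num_field_exists s.
have eqs : map_poly (in_alg Qs) (P * p) %= \prod_(z <- s1) ('X - z%:P).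
  rewrite -(eqp_map QsC) rmorph_prod -map_poly_comp.
  rewrite (eq_map_poly (g := ratr)) => [|c] /=; last first.
    by rewrite alg_num_field fmorph_rat.
  rewrite Es (eqp_ltrans (eqp_scale _ _)) ?lead_coef_eq0 ?map_poly_eq0 //.
  rewrite -Es1 big_map; apply/eqpW/eq_bigr => z _.
  by rewrite rmorphB /= map_polyX map_polyC.
have ax : splitting_field_axiom Qs.
  by exists (map_poly (in_alg Qs) (P * p)); [exact: alg_polyOver | exists s1].
pose E' : splittingFieldType rat :=
  HB.pack (FieldExt.sort Qs) (FieldExt_isSplittingField.Build rat Qs ax).
have sub r : r %| P * p ->
    exists rs : seq E', map_poly (in_alg E') r %= \prod_(z <- rs) ('X - z%:P).
  rewrite -(dvdp_map (in_alg E')) (eqp_dvdr _ eqs) => dvr.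
  by have [m eqm] := dvdp_prod_XsubC dvr; exists (mask m s1).
have [rs eqrs] := sub p (dvdp_mull _ (dvdpp _)).
have [rP eqP] := sub P (dvdp_mulr _ (dvdpp _)).
have [z rz] : exists z, root (map_poly (in_alg E') P) z.
  case: rP eqP => [|z rP] eqP.
    by move: (eqp_size eqP); rewrite big_nil size_poly1 size_map_poly => szP; rewrite szP in sP.
  by exists z; rewrite (eqp_root eqP) root_prod_XsubC mem_head.
have [f] := ahom_of_root genE EP rz.
by exists E', f, rs; split=> //; exact: (inhabits (QsC : {rmorphism E' -> algC})).
Qed.

(** At a prime dividing [t] with exponent [a], the totient has valuation at least [a(d + 2) - 1] and
    [d] at most [d - 1]; so [x] has at least [a(d + 2) - d], which is at least [a]. *)
Lemma totient_expn_dvd (t d x : nat) : (0 < t)%N -> (0 < d)%N ->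
  (totient (t ^ d.+2) %| x * d)%N -> (t %| x)%N.
Proof.
move=> t0 d0 dv; have [-> | x0] := posnP x; first exact: dvdn0.
apply/dvdn_partP => // p; rewrite mem_primes => /and3P[pr_p _ pt].
rewrite p_part pfactor_dvdn //.
have a1 : (0 < logn p t)%N by rewrite -pfactor_dvdn // expn1.
have N0 : (0 < t ^ d.+2)%N by rewrite expn_gt0 t0.
have : (p ^ (logn p (t ^ d.+2)).-1 %| totient (t ^ d.+2))%N.
  rewrite totientE // (bigD1_seq p) ?primes_uniq //=; last first.
    by rewrite mem_primes pr_p N0 Euclid_dvdX ?pt.
  by rewrite -mulnA mulnCA dvdn_mulr.
move/dvdn_trans/(_ dv); rewrite pfactor_dvdn ?muln_gt0 ?x0 // lognM // lognX.
have := ltn_logl p d0; move: (logn p t) (logn p x) (logn p d) a1 => a X y; clear; nia.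
Qed.

(** Cauchy's theorem gives a subgroup of prime order [p] dividing [d]; a subgroup of order [d / p]
    of the quotient is pulled back. *)
Lemma abelian_subgroup_card (gT : finGroupType) (G : {group gT}) (d : nat) :
  abelian G -> (d %| #|G|)%N -> exists H : {group gT}, (H \subset G) && (#|H| == d).
Proof.
elim/ltn_ind: d gT G => d IHd gT G abG dvd.
have [d1 | d1] := leqP d 1.
  have -> : d = 1%N.
    by move: dvd d1; case: d {IHd} => [|[]] //; rewrite dvd0n -leqn0 leqNgt cardG_gt0.
  by exists 1%G; rewrite sub1G cards1 eqxx.
have pr_p := pdiv_prime d1; set p := pdiv d in pr_p.
have pd : (p %| d)%N := pdiv_dvd d.
have [x Gx ox] := Cauchy pr_p (dvdn_trans pd dvd).
have sxG : <[x]> \subset G by rewrite cycle_subG.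
have nxG : <[x]> <| G by rewrite -sub_abelian_normal.
have cardq : (#|(G / <[x]>)%g| * p = #|G|)%N.
  by rewrite card_quotient ?normal_norm // -ox mulnC Lagrange.
have [|||H /andP[sH /eqP cH]] := IHd (d %/ p)%N _ _ (G / <[x]>)%G.
- by rewrite ltn_Pdiv ?prime_gt1 // ltnW.
- exact: quotient_abelian.
- by rewrite -(dvdn_pmul2r (prime_gt0 pr_p)) divnK // cardq.
have [K EK sxK sKG] := inv_quotientS nxG sH.
exists K; rewrite sKG /=.
have nxK : <[x]> <| K := normalS sxK sKG nxG.
have := card_quotient (normal_norm nxK); rewrite -EK cH => Ei.
by rewrite -(Lagrange sxK) -Ei -orderE ox mulnC divnK.
Qed.

(** Irreducibility of the cyclotomic polynomial over Q, transported from [algC] along [g]. *)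
Lemma size_minPoly_prim_root (E : fieldExtType rat) (g : {rmorphism E -> algC}) N (z : E) :
  N.-primitive_root z -> size (minPoly 1 z) = (totient N).+1.
Proof.
move=> prim_z; have prim_gz : N.-primitive_root (g z) by rewrite fmorph_primitive_root.
have [p [Ep monp minp]] := minCpolyP (g z).
have gp (s : {poly rat}) : map_poly g (map_poly (in_alg E) s) = map_poly ratr s.
  by rewrite -map_poly_comp; apply: eq_map_poly => c /=; rewrite alg_num_field fmorph_rat.
have sp : size p = (totient N).+1.
  by rewrite -(size_map_poly (ratr : {rmorphism rat -> algC})) -Ep
    (minCpoly_cyclotomic prim_gz) size_cyclotomic.
have /polyOver1P[P EP] := minPolyOver 1 z.
have dv1 : minPoly 1 z %| map_poly (in_alg E) p.
  apply: minPoly_dvdp; first exact: alg_polyOver.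
  by rewrite -(fmorph_root g) gp -Ep root_minCpoly.
have dv2 : map_poly (in_alg E) p %| minPoly 1 z.
  by rewrite EP dvdp_map -minp -gp fmorph_root -EP root_minPoly.
have /eqp_size -> : minPoly 1 z %= map_poly (in_alg E) p by rewrite /eqp dv1.
by rewrite size_map_poly.
Qed.

Lemma natr_rat_eq0 (E : fieldExtType rat) n : (n%:R == 0 :> E) = (n == 0).
Proof. by rewrite -scaler_nat scaler_eq0 oner_eq0 orbF pnatr_eq0. Qed.

(** * Cyclotomic extensions and their abelian subextensions *)

Section Cyclotomic.
Variables (E : splittingFieldType rat) (K : {subfield E}) (N : nat) (z : E).
Hypothesis prim_z : N.-primitive_root z.

Lemma galois_prim_root : galois K <<K; z>>.
Proof.
have N0 := prim_order_gt0 prim_z.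
apply/splitting_galoisField; exists ('X^N - 1); split.
- by rewrite rpredB ?rpredX ?polyOverX ?rpred1.
- by rewrite separable_Xn_sub_1 // natr_rat_eq0 -lt0n.
exists [seq z ^+ i | i <- index_iota 0 N].
  by rewrite big_map (factor_Xn_sub_1 prim_z) eqpxx.
apply/eqP; rewrite eqEsubv; apply/andP; split.
  apply/Fadjoin_seqP; split; first exact: subv_adjoin.
  by move=> _ /mapP[i _ ->]; rewrite rpredX ?memv_adjoin.
apply/FadjoinP; split; first exact: subv_adjoin_seq.
have [i Ei] := prim_rootP prim_z (prim_expr_order prim_z).
apply: seqv_sub_adjoin; apply/mapP; exists (i : nat) => //.
by rewrite mem_index_iota ltn_ord.
Qed.

Lemma abelian_prim_root : abelian 'Gal(<<K; z>> / K).
Proof.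
apply/centsP => x Gx y Gy; apply/eqP.
have zz : z \in <<K; z>>%VS by apply: memv_adjoin.
have pow (w : gal_of <<K; z>>) : exists i, w z = z ^+ i.
  have wzN : w z ^+ N = 1 by rewrite -rmorphXn (prim_expr_order prim_z) rmorph1.
  by have [i Ei] := prim_rootP prim_z wzN; exists i.
have [[i Ei] [j Ej]] := (pow x, pow y).
rewrite gal_adjoin_eq ?groupM // !galM // Ei Ej !rmorphXn /= Ei Ej.
by rewrite -!exprM mulnC.
Qed.
End Cyclotomic.

(** The degree of [z] over Q, the totient of [N], divides [[K(z):K] [K:Q]]; the exponent in [N] is
    chosen so that [totient_expn_dvd] yields [t | [K(z):K]]. [F] is the fixed field of a subgroup of
    index [t], which is normal since the group is abelian. *)
Theorem abelian_extension (E : fieldExtType rat) (K : {subfield E}) (t : nat) : (0 < t)%N ->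
  exists (E1 : splittingFieldType rat) (f : 'AHom(E, E1)) (F : {subfield E1}),
    galois (f @: K) F /\ \dim_(f @: K) F = t.
Proof.
move=> t0; pose N := (t ^ (\dim K).+2)%N.
have N0 : (0 < N)%N by rewrite expn_gt0 t0.
have p0 : 'X^N - 1 != 0 :> {poly rat} by rewrite monic_neq0 // monicXnsubC.
have [E1 [f [rs [eqrs [g]]]]] := splitting_extension E p0.
exists E1, f; set K1 := (f @: K)%AS.
have p1E : map_poly (in_alg E1) ('X^N - 1) = 'X^N - 1.
  by rewrite rmorphB /= map_polyXn rmorph1.
rewrite p1E in eqrs.
have Ers : 'X^N - 1 = \prod_(z <- rs) ('X - z%:P).
  by apply/eqP; rewrite -eqp_monic ?monic_prod_XsubC // monicXnsubC.
have : has N.-primitive_root rs.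
  apply: has_prim_root => //.
  - by apply/allP=> z; rewrite -root_prod_XsubC -Ers.
  - by rewrite -separable_prod_XsubC -Ers separable_Xn_sub_1 // natr_rat_eq0 -lt0n.
  - by rewrite -ltnS -(size_prod_XsubC rs id) -Ers size_XnsubC.
case/hasP=> z _ prim_z; have galz := galois_prim_root K1 prim_z.
have tdv : (t %| #|'Gal(<<K1; z>> / K1)|)%N.
  rewrite -galois_dim //.
  have dK : \dim K1 = \dim K by rewrite limg_dim_eq ?(eqP (AHom_lker0 f)) ?capv0.
  apply: (@totient_expn_dvd t (\dim K)); rewrite ?adim_gt0 //.
  rewrite -/N -{1}dK -dim_sup_field ?subv_adjoin //.
  have : (\dim <<1; z>> %| \dim <<K1; z>>)%N.
    by apply: field_dimS; apply/adjoinSl; rewrite sub1v.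
  apply: dvdn_trans; rewrite dim_Fadjoin dimv1 muln1.
  by have := size_minPoly_prim_root g prim_z; rewrite size_minPoly => -[->].
have [H /andP[sH /eqP cH]] : exists H : {group gal_of <<K1; z>>},
    (H \subset 'Gal(<<K1; z>> / K1)) && (#|H| == #|'Gal(<<K1; z>> / K1)| %/ t)%N.
  by apply: abelian_subgroup_card; [apply: abelian_prim_root prim_z | apply: dvdn_div].
have nH : H <| 'Gal(<<K1; z>> / K1).
  by rewrite -sub_abelian_normal // (abelian_prim_root K1 prim_z).
exists (fixedField H)%AS; split; first exact: normal_fixedField_galois galz _ nH.
rewrite (dim_fixed_galois galz sH) -divgS // cH.
by rewrite divnA // mulKn // cardG_gt0.
Qed.

(** * Extensions without new Galois subextensions *)

(** A uniformizer has odd valuation. In terms of [N]: a value below 1 is at most [1/q], and its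
    square is then strictly below [1/q]. *)
Lemma place_unif_nonsquare (F0 : fieldType) (L : fieldExtType F0) (U : {subfield L})
    (q : nat) (N : L -> rat) (y : L) :
  place U q N -> y \in U -> N (y ^+ 2) <> q%:R^-1.
Proof.
move=> plN Uy; rewrite (placeX plN) // => Ny.
have rho0 := place_rho_gt0 plN; have rho1 := place_rho_lt1 plN.
have Ny0 := place_ge0 plN Uy.
have Ny1 : N y < 1 by rewrite -(@ltr_pXn2r _ 2) ?nnegrE ?expr1n // Ny.
have := place_discrete plN Uy Ny1.
move: Ny rho0 rho1; set rho := q%:R^-1 => Ny rho0 rho1; nra.
Qed.

Lemma place_nat_coprime (F0 : fieldType) (L : fieldExtType F0) (U : {subfield L})
    (q : nat) (N : L -> rat) (n : nat) :
  place U q N -> coprime n q -> N n%:R = 1.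
Proof.
move=> plN co; have n0 : (0 < n)%N.
  by case: n co => //; rewrite /coprime gcd0n => /eqP q1; have := place_gt1 plN; rewrite q1.
case: (egcdnP q n0) => u v Eu _; rewrite (eqP co) in Eu.
have E1 : (1 : L) = u%:R * n%:R - v%:R * q%:R by rewrite -!natrM Eu natrD addrC addKr.
have Unat k : k%:R \in U by rewrite rpred_nat.
apply/eqP; rewrite eq_le (place_nat_le plN) leNgt; apply/negP => Nn.
suffices : N 1 < 1 by rewrite (place1 plN) ltxx.
rewrite E1 (le_lt_trans (placeB plN _ _)) ?rpredM // gt_max !(placeM plN) //.
have N1 k : N k%:R <= 1 := place_nat_le plN k.
have N0 k : 0 <= N k%:R by apply: (place_ge0 plN).
rewrite (le_lt_trans _ Nn) ?ler_piMl //=.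
by rewrite (le_lt_trans _ (place_rho_lt1 plN)) // (place_unif plN) ler_piMl // invr_ge0.
Qed.

Lemma place_aimg (F0 : fieldType) (L L' : fieldExtType F0) (f : 'AHom(L, L'))
    (U : {subfield L}) (q : nat) (N : L -> rat) :
  place U q N -> exists N' : L' -> rat, place (f @: U) q N' /\ forall x, N' (f x) = N x.
Proof.
move=> plN; have fK : cancel f (f^-1)%VF by move=> x; rewrite lker0_lfunK ?AHom_lker0.
exists (N \o (f^-1)%VF); split=> [|x]; last by rewrite /= fK.
split=> /=.
- exact: place_gt1 plN.
- by move=> _ /memv_imgP[x Ux ->]; rewrite fK (place_ge0 plN).
- by move=> _ /memv_imgP[x Ux ->]; rewrite fK (place_eq0 plN) // fmorph_eq0.
- move=> _ _ /memv_imgP[x Ux ->] /memv_imgP[y Uy ->].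
  by rewrite -rmorphM !fK (placeM plN).
- move=> _ _ /memv_imgP[x Ux ->] /memv_imgP[y Uy ->].
  by rewrite -rmorphD !fK (placeD plN).
- by rewrite -(rmorph_nat f) fK (place_unif plN).
by move=> _ /memv_imgP[x Ux ->]; rewrite fK; apply: place_discrete plN _ Ux.
Qed.

Lemma galois_aimg (F0 : fieldType) (L L' : splittingFieldType F0) (f : 'AHom(L, L'))
    (K F : {subfield L}) :
  galois K F -> galois (f @: K) (f @: F).
Proof.
case/splitting_galoisField=> p [Kp sepp [rs Ep EF]].
apply/splitting_galoisField; exists (map_poly f p); split.
- by apply/polyOver_poly=> i _; apply/memv_img/polyOverP.
- by rewrite separable_map.
exists [seq f x | x <- rs]; last by rewrite -aimg_adjoin_seq EF.
rewrite big_map; move: Ep; rewrite -(eqp_map f) rmorph_prod /=.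
by under eq_bigr do rewrite rmorphB /= map_polyX map_polyC.
Qed.

Lemma minPoly_subfield (F0 : fieldType) (L : fieldExtType F0) (U V : {subfield L})
    (x : L) (p : {poly L}) :
  (U <= V)%VS -> minPoly V x = p -> p \is a polyOver U -> minPoly U x = p.
Proof.
move=> sUV <- Up; apply/eqP; rewrite -eqp_monic ?monic_minPoly //.
by rewrite /eqp minPoly_dvdp ?root_minPoly //= minPolyS.
Qed.

Lemma adjoin_degree_sqrt (F0 : fieldType) (E : fieldExtType F0) (F : {subfield E}) (r : E) :
  r \notin F -> r ^+ 2 \in F -> adjoin_degree F r = 2%N.
Proof.
move=> Fr Fa.
have : minPoly F r %| 'X^2 - (r ^+ 2)%:P.
  apply: minPoly_dvdp; first by rewrite rpredB ?rpredX ?polyOverX ?polyOverC.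
  by rewrite rootE hornerD hornerN hornerC hornerXn subrr.
move/dvdp_leq; rewrite -size_poly_gt0 size_XnsubC // size_minPoly => /(_ isT) le.
have := adjoin_deg_eq1 F r; rewrite (negPf Fr); move: le.
by rewrite /adjoin_degree; case: (_.-1) => [|[|]].
Qed.

(** * Galois subextensions of a doubly transitive or quadratic extension *)

Section GaloisSub.
Variables (F0 : fieldType) (E : splittingFieldType F0) (K F F' : {subfield E}).
Hypothesis galF' : galois K F'.

(** Since [size s] is at most [deg P = size Q], divisibility gives [s - s(b) = c Q] with [c]
    constant. If [c] is not 0, the leading coefficient shows that [c] lies in [F], and the next
    coefficient of [Q], which is [alpha] plus a coefficient of [P], puts [alpha] in [F]. *)
Lemma galois_sub_two_transitive (alpha : E) :
  let P := minPoly F alpha in let Q := P %/ ('X - alpha%:P) in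
  (K <= F)%VS -> (3 < size P)%N -> (forall b, root Q b -> minPoly <<F; alpha>> b = Q) ->
  (F' <= <<F; alpha>>)%VS -> (F' <= F)%VS.
Proof.
move=> P Q sKF sP minQ sF'L; apply/subvP=> beta F'b.
have EP : P = Q * ('X - alpha%:P) by rewrite divpK // dvdp_XsubCl root_minPoly.
have monQ : Q \is monic by rewrite -(monicMr _ (monicXsubC alpha)) -EP monic_minPoly.
have sQ : size P = (size Q).+1.
  by rewrite EP size_Mmonic ?monic_neq0 ?monicXsubC // size_XsubC addn2.
have FP : P \is a polyOver F := minPolyOver F alpha.
have [b Qb] : exists b, root Q b.
  have [r /eqP Er] := splitting_field_normal F alpha.
  have : Q %| \prod_(y <- r) ('X - y%:P) by rewrite -Er -/P EP dvdp_mulr.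
  case/dvdp_prod_XsubC=> m eqm; case Em: (mask m r) eqm => [|b l] eqm.
    by move: (eqp_size eqm); rewrite big_nil size_poly1 => sQ1; rewrite sQ sQ1 in sP.
  by exists b; rewrite (eqp_root eqm) root_prod_XsubC mem_head.
have Pb : root P b by rewrite EP rootM Qb.
set s := Fadjoin_poly F alpha beta.
have Fs : s \is a polyOver F := Fadjoin_polyOver _ _ _.
have sa : s.[alpha] = beta by rewrite Fadjoin_poly_eq // (subvP sF'L).
have F'sb : s.[b] \in F'.
  have [_ _ nF'] := and3P galF'.
  have [r /allP rF' Er] := normalFieldP nF' _ F'b.
  apply: rF'; rewrite -root_prod_XsubC -Er.
  have /dvdpP[k Ek] : P %| minPoly K beta \Po s.
    apply: minPoly_dvdp; last by rewrite rootE horner_comp sa minPolyxx.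
    by rewrite polyOver_comp // (polyOverSv sKF) // minPolyOver.
  by rewrite rootE -horner_comp Ek -rootE rootM Pb orbT.
have Lsb := subvP sF'L _ F'sb.
have : Q %| s - s.[b]%:P.
  rewrite -(minQ b Qb) minPoly_dvdp //; last by rewrite rootE hornerD hornerN hornerC subrr.
  rewrite rpredB ?polyOverC //.
  by apply: (polyOverSv (subv_adjoin F alpha)).
case/dvdpP=> k Ek; have [k0 | k0] := eqVneq k 0.
  move: Ek; rewrite k0 mul0r => /eqP; rewrite subr_eq0 => /eqP Es.
  have := polyOverP Fs 0; rewrite {1}Es coefC eqxx.
  by rewrite -sa Es hornerC hornerC.
have Q0 := monic_neq0 monQ.
have sk : (size k <= 1)%N.
  have : (size (s - s.[b]%:P)%R <= size Q)%N.
    rewrite (leq_trans (size_polyD _ _)) // geq_max size_polyN size_polyC.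
    have -> : size Q = adjoin_degree F alpha.
      by have := size_minPoly F alpha; rewrite -/P sQ => -[].
    by rewrite size_Fadjoin_poly (leq_trans (leq_b1 _)).
  rewrite Ek size_mul // => le; move: sP sQ le; move: (size k) (size Q) => x y; clear; lia.
have [c Ec] : exists c, k = c%:P by exists k`_0; apply: size1_polyC.
have c0 : c != 0 by rewrite -(polyC_eq0 c) -Ec.
set m := size Q in sQ sP.
have coef i : (0 < i)%N -> s`_i = c * Q`_i.
  move=> i0; have := congr1 (fun p : {poly E} => p`_i) Ek.
  by rewrite Ec coefCM coefB coefC (gtn_eqF i0) subr0.
have m3 : (2 < m)%N by rewrite -ltnS -sQ.
have Fc : c \in F.
  suff <- : s`_m.-1 = c by apply: (polyOverP Fs).
  rewrite coef; last by case: (m) m3 => [|[|]].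
  by rewrite -lead_coefE (monicP monQ) mulr1.
(* Here [deg P > 2] enters: the index [m.-2] is positive, so the constant [s.[b]] does not
   interfere. *)
have FQ : Q`_m.-2 \in F.
  have -> : Q`_m.-2 = s`_m.-2 / c.
    by rewrite coef ?[c * _]mulrC ?mulfK //; case: (m) m3 => [|[|[|]]].
  by rewrite rpred_div // (polyOverP Fs).
have Fa : alpha \in F.
  have -> : alpha = Q`_m.-2 - P`_m.-1.
    have Em : m.-1 = m.-2.+1 by case: (m) m3 => [|[|]].
    rewrite EP mulrBr coefB coefMC -lead_coefE (monicP monQ) mul1r Em coefMX /=.
    by rewrite opprB addrC subrK.
  by rewrite rpredB // (polyOverP FP).
have := adjoin_deg_eq1 F alpha; rewrite Fa => /eqP d1.
by move: sP; rewrite size_minPoly d1.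
Qed.

(** If [b + c r] lies in [F'] with [c] nonzero, stability of [F'] under [x] puts [x r = d + e r] in
    [F(r)]. Its square lies in [F], so [d = 0] or [e = 0]; the former contradicts the condition on
    [x (r ^+ 2)], the latter [r \notin F]. *)
Lemma galois_sub_quadratic (r : E) (x : gal_of F) :
  (2%:R : E) != 0 -> galois K F -> r \notin F -> r ^+ 2 \in F -> x \in 'Gal(F / K) ->
  (forall b, b \in F -> x (r ^+ 2) != b ^+ 2 * r ^+ 2) ->
  (F' <= <<F; r>>)%VS -> (F' <= F)%VS.
Proof.
move=> two0 galF Fr Fa galx nsq sF'L; have [sKF _ _] := and3P galF.
have [_ _ nF'] := and3P galF'.
have deg2 := adjoin_degree_sqrt Fr Fa.
have rep u : u \in <<F; r>>%VS -> exists b c, [/\ b \in F, c \in F & u = b + c * r].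
  move=> Lu; pose s := Fadjoin_poly F r u; exists s`_0, s`_1.
  have Fs : s \is a polyOver F := Fadjoin_polyOver _ _ _.
  rewrite !(polyOverP Fs); split=> //.
  rewrite -(Fadjoin_poly_eq Lu) -/s (@horner_coef_wide _ 2) ?size_Fadjoin_poly -?deg2 //.
    by rewrite deg2 !big_ord_recl big_ord0 addr0 expr0 mulr1 expr1.
  by rewrite size_Fadjoin_poly.
(* An element of [gal_of F] is represented by an automorphism of all of [E], so it also acts on [F']
   and on [r]. *)
have xF' u : u \in F' -> x u \in F'.
  move=> F'u; have xK : gal_repr x \in kAEndf K.
    by rewrite inE kAutfE; apply/kAHomP=> v Kv; apply: fixed_gal galx Kv.
  by rewrite -(eqP (forall_inP nF' _ xK)) memv_img.
apply/subvP=> beta F'b; have [b [c [Fb Fc Eb]]] := rep _ (subvP sF'L _ F'b).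
have [c0 | c0] := eqVneq c 0; first by rewrite Eb c0 mul0r addr0.
have Lxr : x r \in <<F; r>>%VS.
  have xF u : u \in F -> x u \in <<F; r>>%VS.
    by move=> Fu; rewrite subvP_adjoin // memv_gal.
  have -> : x r = (x beta - x b) / x c.
    by rewrite Eb rmorphD rmorphM /= addrC addKr mulrC mulKf // fmorph_eq0.
  have Lxb : x beta \in <<F; r>>%VS by apply: (subvP sF'L); apply: xF'.
  by rewrite rpred_div ?rpredB // xF.
have [d [e [Fd Fe Exr]]] := rep _ Lxr.
have Fxa : x (r ^+ 2) \in F by rewrite memv_gal.
have Exa : x (r ^+ 2) = d ^+ 2 + e ^+ 2 * r ^+ 2 + 2%:R * d * e * r.
  by rewrite rmorphXn /= Exr; ring.
have : d * e == 0.
  apply: contraR Fr => de0; have de2 : 2%:R * d * e != 0 by rewrite -mulrA mulf_neq0.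
  have -> : r = (x (r ^+ 2) - (d ^+ 2 + e ^+ 2 * r ^+ 2)) / (2%:R * d * e).
    by rewrite Exa addrC addKr mulrC mulKf.
  have F1 : d ^+ 2 + e ^+ 2 * r ^+ 2 \in F.
    by rewrite rpredD ?(rpredX 2 Fd) // rpredM // rpredX.
  have F2 : 2%:R * d * e \in F by rewrite !rpredM ?rpred_nat.
  by rewrite rpred_div // rpredB.
rewrite mulf_eq0 => /orP[/eqP d0 | /eqP e0].
  by case/negP: (nsq e Fe); rewrite Exa d0 expr0n mulr0 !mul0r addr0 add0r.
case/negP: Fr; have : x r \in (x @: F)%VS by rewrite limg_gal Exr e0 mul0r addr0.
by case/memv_imgP=> u Fu /fmorph_inj ->.
Qed.
End GaloisSub.

(** * Construction of the extensions of [F] *)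

Lemma ascending_index_of (E : splittingFieldType rat) (K F L : {subfield E}) (m t : nat) :
  galois K F -> \dim_K F = t -> (F <= L)%VS -> \dim L = (m * \dim F)%N ->
  (forall F' : {subfield E}, (F' <= L)%VS -> galois K F' -> (F' <= F)%VS) ->
  [/\ (K <= L)%VS, \dim_K L = (m * t)%N & has_ascending_index K L t].
Proof.
move=> galF dF sFL dL maxF; have [sKF _ _] := and3P galF.
split; first exact: subv_trans sFL.
  by rewrite dL (dim_sup_field sKF) dF mulnA mulnK ?adim_gt0.
exists F; split=> // F' sF'L galF'.
by rewrite -dF leq_div2r // dimvS // maxF.
Qed.

(** [E] is finite over Q and may be too small for [L]; in the larger [E'], [K] and [F] are replaced
    by their images. *)
Definition extends_without_galois (E : splittingFieldType rat) (K F : {subfield E}) (m : nat) :=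
  exists (E' : splittingFieldType rat) (f : 'AHom(E, E')) (L : {subfield E'}),
    [/\ (f @: F <= L)%VS, \dim L = (m * \dim F)%N &
        forall F' : {subfield E'}, (F' <= L)%VS -> galois (f @: K) F' -> (F' <= f @: F)%VS].

Lemma dim_aimg (F0 : fieldType) (L L' : fieldExtType F0) (f : 'AHom(L, L')) (U : {vspace L}) :
  \dim (f @: U) = \dim U.
Proof. by rewrite limg_dim_eq ?(eqP (AHom_lker0 f)) ?capv0. Qed.

Lemma exists_quadratic (E : splittingFieldType rat) (K F : {subfield E}) :
  galois K F -> ~~ (F <= K)%VS -> extends_without_galois K F 2.
Proof.
move=> galF nFK; have [sKF _ nF] := and3P galF.
have [theta Ft Kt] := subvPn nFK.
have [rs /allP rsF Ers] := normalFieldP nF theta Ft.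
(* With these differences units, every other conjugate of a small translate of [theta] is a unit. *)
pose S := [seq y - theta | y <- rs & y != theta].
have S0 : 0 \notin S.
  by apply/mapP=> [[y]]; rewrite mem_filter -subr_eq0 => /andP[yt _] E0; rewrite -E0 eqxx in yt.
have [q [N [pr_q plN NS dens]]] := exists_place S0.
have rho0 := place_rho_gt0 plN.
have [c Nc] := dens theta _ rho0.
(* [theta - c] has absolute value below [1/q]; subtracting [q] makes it exactly [1/q]. *)
pose a := theta - c%:A - q%:R.
have F1 (b : rat) : b%:A \in F by rewrite rpredZ ?mem1v.
have Fa : a \in F by rewrite !rpredB ?rpred_nat.
have Na : N a = q%:R^-1.
  rewrite /a addrC (placeD_eq plN) ?memvf // (placeN plN) ?memvf // (place_unif plN) //.
have nsqE y : y ^+ 2 <> a.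
  by move=> Ey; apply: (place_unif_nonsquare plN (memvf y)); rewrite Ey.
have /polyOver1P[P EP] := minPolyOver 1 a.
have P0 : P != 0 by rewrite -(map_poly_eq0 (in_alg E)) -EP monic_neq0 ?monic_minPoly.
(* [splitting_extension] takes rational polynomials, so [X^2 - a] is replaced by its multiple
   [P(X^2)]. *)
have PX0 : P \Po 'X^2 != 0 by rewrite comp_poly_eq0 ?size_polyXn.
have [E' [f [rs' [eqrs _]]]] := splitting_extension E PX0.
have [r Er] : exists r, r ^+ 2 = f a.
  have : 'X^2 - (f a)%:P %| \prod_(z <- rs') ('X - z%:P).
    rewrite -(eqp_dvdr _ eqrs) map_comp_poly map_polyXn.
    have -> : 'X^2 - (f a)%:P = ('X - (f a)%:P) \Po 'X^2
      by rewrite comp_polyB comp_polyX comp_polyC.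
    apply: dvdp_comp_poly; rewrite dvdp_XsubCl.
    have := root_minPoly 1 a; rewrite EP -(fmorph_root f) -map_poly_comp.
    rewrite (eq_map_poly (g := in_alg E')) // => b /=; rewrite linearZ /= rmorph1 //.
  case/dvdp_prod_XsubC=> m eqm; case Em: (mask m rs') eqm => [|r l] eqm.
    by move: (eqp_size eqm); rewrite big_nil size_poly1 size_XnsubC.
  exists r; apply/eqP; rewrite -subr_eq0.
  have := mem_head r l; rewrite -root_prod_XsubC -(eqp_root eqm) rootE.
  by rewrite hornerD hornerN hornerC hornerXn.
pose K' := (f @: K)%AS; pose F' := (f @: F)%AS.
have galF' : galois K' F' := galois_aimg f galF.
have F'r : r \notin F'.
  apply/negP=> /memv_imgP[y Fy Ey]; apply: (nsqE y); apply: (fmorph_inj f).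
  by rewrite rmorphXn /= -Ey Er.
have F'a : r ^+ 2 \in F' by rewrite Er memv_img.
have [x galx xt] : exists2 x, x \in 'Gal(F' / K') & x (f theta) != f theta.
  have K't : f theta \notin K'.
    by apply: contra Kt => /memv_imgP[y Ky /fmorph_inj ->].
  apply/exists_inP; apply: contraR K't; rewrite negb_exists_in => /forall_inP fixt.
  rewrite -(galois_fixedField galF'); apply/fixedFieldP; first exact: memv_img.
  by move=> x /fixt; rewrite negbK => /eqP.
exists E', f, <<F'; r>>%AS; split.
- exact: subv_adjoin.
- rewrite dim_Fadjoin dim_aimg; congr (_ * _)%N.
  exact: adjoin_degree_sqrt F'r F'a.
move=> F2 sF2 galF2.
apply: (galois_sub_quadratic galF2 _ galF' F'r F'a galx _ sF2) => {sF2}.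
  by rewrite natr_rat_eq0.
move=> b F'b; apply/eqP=> E1.
have [y Fy Ey] := memv_imgP F'b.
have : x (f theta) \in F' by rewrite memv_gal // memv_img.
case/memv_imgP=> th' Fth' Eth'.
have th'S : th' - theta \in S.
  apply: map_f; rewrite mem_filter; apply/andP; split.
    by apply: contraNneq xt => Et; rewrite Eth' Et.
  have : root (minPoly K' (f theta)) (x (f theta)).
    by apply: (root_minPoly_gal _ galx); rewrite ?limgS ?memv_img.
  by rewrite Eth' -map_minPoly fmorph_root Ers root_prod_XsubC.
have : N ((th' - theta) + a) = 1.
  by rewrite (placeD_eq plN) ?memvf ?(NS _ th'S) ?Na ?(place_rho_lt1 plN).
have Exa : x (f a) = f ((th' - theta) + a).
  have -> : (th' - theta) + a = th' - c%:A - q%:R by rewrite /a !addrA subrK.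
  by rewrite /a !rmorphB !rmorph_nat /= !linearZ /= !rmorph1 Eth'.
move: E1; rewrite Er Ey Exa -rmorphXn -rmorphM => /fmorph_inj -> Ny.
(* The conjugate [y ^+ 2 * a] is a unit and [N a = 1/q], so the square of [y] has absolute value
   [q]. *)
apply: (place_unif_nonsquare plN (memvf y^-1)).
rewrite exprVn (placeV plN) ?memvf //; apply: mulr1_eq.
by move: Ny; rewrite (placeM plN) ?memvf // Na.
Qed.

Definition two_prime_poly (R : nzRingType) (m q1 q2 : nat) : {poly R} :=
  'X^m + q1%:R *: 'X^(m.-1) + ((q1 * q2)%N%:R)%:P.

Lemma exists_two_transitive (E : splittingFieldType rat) (K F : {subfield E}) (m : nat) :
  galois K F -> (2 < m)%N -> extends_without_galois K F m.
Proof.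
move=> galF m3; have [sKF _ _] := and3P galF.
have [q1 [N1 [pr_q1 plN1 _ _]]] := @exists_place E [::] isT.
(* Requiring [q1] to be a unit at the second place makes the two primes distinct. *)
have [q2 [N2 [pr_q2 plN2 NS _]]] : exists q N, [/\ prime q, place {:E} q N,
    {in [:: q1%:R], forall x, N x = 1} & forall x e, 0 < e -> exists c : rat, N (x - c%:A) < e].
  by apply: exists_place; rewrite inE eq_sym natr_rat_eq0 -lt0n prime_gt0.
have N2q1 : N2 q1%:R = 1 by apply: NS; rewrite inE.
have co : coprime q2 q1.
  rewrite prime_coprime // dvdn_prime2 //; apply/eqP=> Eq.
  by have := place_rho_lt1 plN2; rewrite -(place_unif plN2) Eq N2q1 ltxx.
pose p (R : nzRingType) := two_prime_poly R m q1 q2.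
have m0 : (0 < m)%N by apply: ltn_trans m3.
have coefp R i : (p R)`_i = (i == m)%:R + q1%:R * (i == m.-1)%:R + (q1 * q2)%N%:R *+ (i == 0%N).
  by rewrite /p /two_prime_poly !coefD coefZ !coefXn coefC; case: (i == 0%N).
have pnat i : exists k, forall R, (p R)`_i = k%:R.
  exists ((i == m) + q1 * (i == m.-1) + q1 * q2 * (i == 0%N))%N => R.
  by rewrite coefp !natrD !natrM -[q1%:R * q2%:R *+ _]mulr_natr.
have coef0 R : (p R)`_0 = (q1 * q2)%N%:R.
  rewrite coefp eqxx mulr1n eq_sym (gtn_eqF m0) eq_sym gtn_eqF ?mulr0 ?add0r //.
  by case: (m) m3 => [|[|]].
have coef_mid R i : (0 < i < m.-1)%N -> (p R)`_i = 0.
  move=> /andP[i0 im]; rewrite coefp !(ltn_eqF im) (gtn_eqF i0) ltn_eqF ?mulr0 ?addr0 //.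
  exact: leq_trans im (leq_pred m).
have coef_top R : (p R)`_m.-1 = q1%:R.
  rewrite coefp eqxx mulr1 ltn_eqF ?add0r ?prednK // gtn_eqF ?addr0 //.
  by case: (m) m3 => [|[|]].
have size_p (R : nzRingType) : size (p R) = m.+1.
  rewrite /p /two_prime_poly -addrA size_polyDl size_polyXn // ltnS.
  rewrite (leq_trans (size_polyD _ _)) // geq_max
    (leq_trans (size_scale_leq _ _)) ?size_polyXn ?prednK //.
  by rewrite (leq_trans (size_polyC_leq1 _)).
have mon_p R : p R \is monic.
  by rewrite monicE lead_coefE size_p /= coefp eqxx gtn_eqF ?prednK // (gtn_eqF m0) mulr0 !addr0.
have map_p (R S : nzRingType) (g : {rmorphism R -> S}) : map_poly g (p R) = p S.
  by rewrite /p /two_prime_poly !rmorphD /= map_polyZ !map_polyXn map_polyC /= !rmorph_nat.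
have [E' [f [rs' [eqrs _]]]] := splitting_extension E (monic_neq0 (mon_p rat)).
rewrite (map_p rat E' (in_alg E')) in eqrs.
(* The places live on all of [E], so minimal polynomials are found over [M] and then descended to
   [F'] by [minPoly_subfield]. *)
pose M := (f @: {:E})%AS; pose F' := (f @: F)%AS.
have sFM : (F' <= M)%VS by rewrite limgS // subvf.
have Up (U : {subfield E'}) : p E' \is a polyOver U.
  rewrite /p /two_prime_poly -mul_polyC !rpredD ?rpredM ?rpredX ?polyOverX //.
    by rewrite polyOverC rpred_nat.
  by rewrite polyOverC rpred_nat.
have [alpha pa] : exists alpha, root (p E') alpha.
  case: rs' eqrs => [|z l] eqrs.
    by move: (eqp_size eqrs); rewrite big_nil size_poly1 size_p => -[Em]; rewrite Em in m0.
  by exists z; rewrite (eqp_root eqrs) root_prod_XsubC mem_head.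
have [N1' [plN1' _]] := place_aimg f plN1.
have [N2' [plN2' N2'f]] := place_aimg f plN2.
have N2'q1 : N2' q1%:R = 1 by rewrite -(rmorph_nat f) N2'f.
have minM : minPoly M alpha = p E'.
  have N1p0 : N1' (p E')`_0 = q1%:R^-1.
    rewrite coef0 natrM (placeM plN1') ?rpred_nat // (place_unif plN1').
    by rewrite (place_nat_coprime plN1') ?mulr1.
  apply: (place_eisenstein plN1' (Up M) (mon_p E') pa) => // i; rewrite size_p /= => im.
  have rho1 := place_rho_lt1 plN1'.
  have [-> | i0] := posnP i; first by rewrite N1p0.
  have [im1 | ] := ltnP i m.-1; first by rewrite coef_mid ?i0 // (place0 plN1').
  move=> lemi; have -> : i = m.-1 by apply/eqP; rewrite eqn_leq lemi andbT -ltnS prednK.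
  by rewrite coef_top (place_unif plN1').
have minF : minPoly F' alpha = p E' := minPoly_subfield sFM minM (Up F').
have degM : adjoin_degree F' alpha = m.
  by have := size_minPoly F' alpha; rewrite minF size_p => -[].
exists E', f, <<F'; alpha>>%AS; split.
- exact: subv_adjoin.
- by rewrite dim_Fadjoin degM dim_aimg.
move=> F2 sF2 galF2.
apply: (galois_sub_two_transitive galF2 (limgS f sKF)) sF2; first by rewrite minF size_p.
rewrite minF => b; set Q := p E' %/ _ => Qb.
have EQ : p E' = Q * ('X - alpha%:P) by rewrite divpK // dvdp_XsubCl.
have monQ : Q \is monic by rewrite -(monicMr _ (monicXsubC alpha)) -EQ mon_p.
have sQ : size Q = m.
  apply: succn_inj; rewrite -(size_p E') EQ.
  by rewrite size_Mmonic ?monic_neq0 ?monicXsubC // size_XsubC addn2.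
have UQ (U : {subfield E'}) : (F' <= U)%VS -> alpha \in U -> Q \is a polyOver U.
  by move=> sFU Ua; rewrite divp_polyOver ?polyOverXsubC ?Up.
have UQa (U : {subfield E'}) : (F' <= U)%VS -> Q \is a polyOver <<U; alpha>>%AS.
  by move=> sFU; rewrite UQ ?memv_adjoin // (subv_trans sFU) ?subv_adjoin.
have UQF := UQa F' (subvv _); have UQM := UQa M sFM.
apply: (minPoly_subfield (V := <<M; alpha>>%AS)) UQF; first exact: adjoinSl.
(* At [- q1] the first two terms cancel, so the polynomial takes the value [q1 * q2], small at [q2],
   and its derivative is [a ^+ m.-1], a unit there. Hence the place extends to [M(alpha)] with
   [alpha] close to [- q1]. *)
pose a : E' := - q1%:R.
have Ma : a \in M by rewrite rpredN rpred_nat.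
have Na : N2' a = 1 by rewrite (placeN plN2') ?rpred_nat.
have [||||N3 [plN3 N3M _ close]] := @place_extension _ _ M q2 N2' plN2' alpha a _ Ma.
- by move=> i; have [k Ek] := pnat i; rewrite minM Ek (place_nat_le plN2').
- by rewrite Na.
- rewrite minM (_ : _.[a] = (q1 * q2)%:R).
    by rewrite natrM (placeM plN2') ?rpred_nat // N2'q1 mul1r (place_unif plN2')
      (place_rho_lt1 plN2').
  rewrite /p /two_prime_poly !hornerE -[in a ^+ m](prednK m0) exprS /a mulNr.
  by rewrite addNr add0r.
- rewrite minM (_ : _.[a] = a ^+ m.-1).
    by rewrite (placeX plN2') // Na expr1n.
  rewrite /p /two_prime_poly !derivD derivZ !derivXn derivC addr0 !hornerE !hornerMn !hornerXn.
  have -> : q1%:R * (a ^+ m.-2 *+ m.-1) = - (a ^+ m.-1 *+ m.-1).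
    have Em : m.-1 = m.-2.+1 by case: (m) m3 => [|[|]].
    by rewrite {3}Em exprS -mulNrn -mulNr opprK mulrnAr.
  by rewrite -{2}(prednK m0) mulrS addrK.
have La : alpha \in <<M; alpha>>%VS := memv_adjoin _ _.
have N3a : N3 alpha = 1.
  have N3a' : N3 a = 1 by rewrite N3M.
  have L_a : a \in <<M; alpha>>%VS by rewrite subvP_adjoin.
  by rewrite -(subrK a alpha) addrC (placeD_eq plN3) ?N3a' ?rpredB.
(* In [p = Q * ('X - alpha)] the constant terms give the case [i = 0], and each vanishing middle
   coefficient of [p] relates consecutive coefficients of [Q] by the unit [alpha]. So [Q] is
   Eisenstein at [q2]. *)
have Qcoef i : (i < m.-1)%N -> N3 Q`_i = q2%:R^-1.
  elim: i => [|i IHi] im.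
    have := congr1 (fun s : {poly E'} => N3 s`_0) EQ.
    rewrite coef0 -!horner_coef0 hornerM hornerXsubC sub0r (placeM plN3) ?rpredN //; last first.
      by rewrite rpred_horner ?mem0v.
    rewrite (placeN plN3) // N3a mulr1 horner_coef0 => <-.
    by rewrite N3M ?rpred_nat // natrM (placeM plN2') ?rpred_nat // N2'q1 mul1r (place_unif plN2').
  have Qi : Q`_i = alpha * Q`_i.+1.
    have := congr1 (fun s : {poly E'} => s`_i.+1) EQ.
    rewrite coef_mid ?mulrBr ?coefB ?coefMX ?coefMC /= => [/esym/eqP|].
      by rewrite subr_eq0 mulrC => /eqP.
    by [].
  rewrite -(IHi (ltnW im)) Qi (placeM plN3) ?N3a ?mul1r //.
  exact: (polyOverP UQM).
apply: (place_eisenstein plN3) => // [i|].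
  by rewrite sQ => /Qcoef ->; apply: place_rho_lt1 plN3.
by rewrite Qcoef //; case: (m) m3 => [|[|]].
Qed.

(** The given [E] may not contain a suitable [L], so the extension is that of the image of [K] in a
    larger field [E']. *)
Theorem theorem9p5 (E : splittingFieldType rat) (K : {subfield E}) (n t : nat) :
  (2 < n)%N -> (0 < t)%N -> (t %| n)%N ->
  exists (E' : splittingFieldType rat) (f : 'AHom(E, E')) (L : {subfield E'}),
    [/\ (f @: K <= L)%VS, \dim_(f @: K) L = n & has_ascending_index (f @: K)%VS L t].
Proof.
move=> n3 t0 /dvdnP[m En].
have [E1 [f1 [F1 [galF1 dF1]]]] := abelian_extension K t0.
have m0 : (0 < m)%N by case: m En n3 => // ->.
have ext : extends_without_galois (f1 @: K)%AS F1 m.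
  have [m3 | ] := ltnP 2 m; first exact: exists_two_transitive.
  case: m m0 En => [|[|[|]]] // _ En _.
    by exists E1, \1%AF, F1; split; rewrite ?lim1g ?mul1n.
  (* For [m = 2], the bound [n > 2] forces [t > 1], hence [F1] differs from the image of [K]; a
     quadratic extension of [K] itself would be Galois. *)
  apply: exists_quadratic => //; apply/negP=> sFK.
  have [sKF _ _] := and3P galF1.
  have EF : (f1 @: K)%VS = F1 :> {vspace E1} by apply/eqP; rewrite eqEsubv sKF.
  by move: dF1; rewrite EF divnn adim_gt0 => Et; rewrite En -Et in n3.
have [E2 [f2 [L [sFL dL maxF]]]] := ext.
exists E2, (f2 \o f1)%AF, L; rewrite limg_comp En.
have galF2 := galois_aimg f2 galF1.
have dF2 : \dim_(f2 @: (f1 @: K)) (f2 @: F1) = t by rewrite !dim_aimg -dF1 dim_aimg.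
apply: (ascending_index_of galF2 dF2 sFL _ maxF).
by rewrite dL dim_aimg.
Qed.
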